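(* Let $f$ be a regular function on a symmetric slice domain $\Omega\subseteq\mathbb{H}$ and let $D_f$ be its degenerate set. Then the restriction $f:\Omega\setminus\overline{D_f}\to\mathbb{H}$ is an open map.
   Context: $\mathbb{H}$ is the real algebra of quaternions, $\mathbb{S}=\{q\in\mathbb{H}: q^2=-1\}$ is the 2-sphere of imaginary units, and for $I\in\mathbb{S}$, $L_I=\mathbb{R}+I\mathbb{R}\simeq\mathbb{C}$. For $x,y\in\mathbb{R}$, $x+y\mathbb{S}=\{x+yJ: J\in\mathbb{S}\}$. A domain is a connected open set. For a domain $\Omega\subseteq\mathbb{H}$ put $\Omega_I=\Omega\cap L_I$. A function $f:\Omega\to\mathbb{H}$ on a domain $\Omega\subseteq\mathbb{H}$ is (slice) regular if for every $I\in\mathbb{S}$ the restriction $f_I=f|_{\Omega_I}$ is holomorphic, meaning $f_I\in C^1(\Omega_I)$ and $\frac12\left(\frac{\partial}{\partial x}+I\frac{\partial}{\partial y}\right)f_I(x+Iy)=0$ on $\Omega_I$. A slice domain is a domain $\Omega\subseteq\mathbb{H}$ intersecting the real axis such that $\Omega_I$ is a domain in $L_I$ for all $I\in\mathbb{S}$. A set $C\subseteq\mathbb{H}$ is (axially) symmetric if for all $x+yI\in C$ with $x,y\in\mathbb{R}$, $I\in\mathbb{S}$, the whole set $x+y\mathbb{S}$ is contained in $C$. The degenerate set $D_f$ of a regular function $f:\Omega\to\mathbb{H}$ on a symmetric slice domain is the union of the 2-spheres $x+y\mathbb{S}\subset\Omega$ (with $x,y\in\mathbb{R}$, $y\neq 0$)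 such that $f|_{x+y\mathbb{S}}$ is constant; $\overline{D_f}$ denotes its closure. *)

(* Defs.v *)
From HB Require Import structures.
From mathcomp Require Export all_boot all_order all_algebra.
From mathcomp Require Export all_classical all_reals all_analysis.
From mathcomp Require Import ring.

Set Implicit Arguments.
Unset Strict Implicit.
Unset Printing Implicit Defensive.

Import Order.TTheory GRing.Theory Num.Theory.
Export numFieldNormedType.Exports.

Local Open Scope classical_set_scope.
Local Open Scope ring_scope.

(* The row q = (q_0, q_1, q_2, q_3) stands for q_0 + q_1 i + q_2 j + q_3 k.
   Pitfall: the norm inherited from 'rV[R]_4 is the sup norm of the coordinates,
   which is equivalent to the Euclidean modulus but not multiplicative; it is
   only used here through the topology and the derivatives it induces. *)
Definition quaternion (R : realType) : Type := 'rV[R]_4.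

HB.instance Definition _ (R : realType) := NormedModule.on (quaternion R).

Section QuaternionAlgebra.
Variable R : realType.
Implicit Types p q r : quaternion R.

Definition quat (a b c d : R) : quaternion R :=
  \row_(i < 4) [:: a; b; c; d]`_i.

Definition quat0 q : R := q ord0 (@Ordinal 4 0 isT).
Definition quat1 q : R := q ord0 (@Ordinal 4 1 isT).
Definition quat2 q : R := q ord0 (@Ordinal 4 2 isT).
Definition quat3 q : R := q ord0 (@Ordinal 4 3 isT).

(* i ^ 2 = j ^ 2 = k ^ 2 = -1, i j = k = - j i, j k = i = - k j,
   k i = j = - i k. *)
Definition quat_mul p q : quaternion R :=
  quat (quat0 p * quat0 q - quat1 p * quat1 q
          - quat2 p * quat2 q - quat3 p * quat3 q)
       (quat0 p * quat1 q + quat1 p * quat0 q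
          + quat2 p * quat3 q - quat3 p * quat2 q)
       (quat0 p * quat2 q - quat1 p * quat3 q
          + quat2 p * quat0 q + quat3 p * quat1 q)
       (quat0 p * quat3 q + quat1 p * quat2 q
          - quat2 p * quat1 q + quat3 p * quat0 q).

Definition quat_one : quaternion R := quat 1 0 0 0.

Lemma quatP p q : quat0 p = quat0 q -> quat1 p = quat1 q ->
  quat2 p = quat2 q -> quat3 p = quat3 q -> p = q.
Proof.
move=> h0 h1 h2 h3; apply/rowP => -[[|[|[|[|//]]]] ilt];
by rewrite (bool_irrelevance ilt isT).
Qed.

Lemma quat0E a b c d : quat0 (quat a b c d) = a.
Proof. by rewrite /quat0 mxE. Qed.
Lemma quat1E a b c d : quat1 (quat a b c d) = b.
Proof. by rewrite /quat1 mxE. Qed.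
Lemma quat2E a b c d : quat2 (quat a b c d) = c.
Proof. by rewrite /quat2 mxE. Qed.
Lemma quat3E a b c d : quat3 (quat a b c d) = d.
Proof. by rewrite /quat3 mxE. Qed.

Lemma quat0D p q : quat0 (p + q) = quat0 p + quat0 q.
Proof. exact: mxE. Qed.
Lemma quat1D p q : quat1 (p + q) = quat1 p + quat1 q.
Proof. exact: mxE. Qed.
Lemma quat2D p q : quat2 (p + q) = quat2 p + quat2 q.
Proof. exact: mxE. Qed.
Lemma quat3D p q : quat3 (p + q) = quat3 p + quat3 q.
Proof. exact: mxE. Qed.

Lemma quat0Z a q : quat0 (a *: q) = a * quat0 q.
Proof. exact: mxE. Qed.
Lemma quat1Z a q : quat1 (a *: q) = a * quat1 q.
Proof. exact: mxE. Qed.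
Lemma quat2Z a q : quat2 (a *: q) = a * quat2 q.
Proof. exact: mxE. Qed.
Lemma quat3Z a q : quat3 (a *: q) = a * quat3 q.
Proof. exact: mxE. Qed.

Definition quatE := (quat0E, quat1E, quat2E, quat3E, quat0D, quat1D, quat2D,
  quat3D, quat0Z, quat1Z, quat2Z, quat3Z).

Lemma quat_mulA : associative quat_mul.
Proof.
by move=> p q r; apply: quatP; rewrite /quat_mul !quatE; ring.
Qed.

Lemma quat_mul1l : left_id quat_one quat_mul.
Proof.
by move=> q; apply: quatP; rewrite /quat_mul /quat_one !quatE; ring.
Qed.

Lemma quat_mul1r : right_id quat_one quat_mul.
Proof.
by move=> q; apply: quatP; rewrite /quat_mul /quat_one !quatE; ring.
Qed.

Lemma quat_mulDl : left_distributive quat_mul +%R.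
Proof.
by move=> p q r; apply: quatP; rewrite /quat_mul !quatE; ring.
Qed.

Lemma quat_mulDr : right_distributive quat_mul +%R.
Proof.
by move=> p q r; apply: quatP; rewrite /quat_mul !quatE; ring.
Qed.

Lemma quat_one_neq0 : quat_one != 0.
Proof.
apply/eqP => /(congr1 quat0); rewrite quat0E /quat0 mxE => /eqP.
by rewrite oner_eq0.
Qed.

HB.instance Definition _ := GRing.Zmodule_isNzRing.Build (quaternion R)
  quat_mulA quat_mul1l quat_mul1r quat_mulDl quat_mulDr quat_one_neq0.

Lemma quat_scaleAl (a : R) p q : a *: (p * q) = a *: p * q.
Proof. by apply: quatP; rewrite /GRing.mul/= /quat_mul !quatE; ring. Qed.

HB.instance Definition _ :=
  GRing.Lmodule_isLalgebra.Build R (quaternion R) quat_scaleAl.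

Lemma quat_scaleAr (a : R) p q : a *: (p * q) = p * (a *: q).
Proof. by apply: quatP; rewrite /GRing.mul/= /quat_mul !quatE; ring. Qed.

HB.instance Definition _ :=
  GRing.Lalgebra_isAlgebra.Build R (quaternion R) quat_scaleAr.

End QuaternionAlgebra.

Section SliceRegular.
Variable R : realType.
Local Notation H := (quaternion R).
Implicit Types (I J : H) (Omega C : set H) (f : H -> H).

Definition imag_units : set H := [set q | q ^+ 2 = -1].

Definition slice_point I (z : R * R) : H := z.1%:A + z.2 *: I.

Definition slice I : set H := range (slice_point I).

Definition sphere (x y : R) : set H :=
  [set slice_point J (x, y) | J in imag_units].

(* As for [connected], the empty set is not excluded. *)
Definition domain (T : topologicalType) (A : set T) := open A /\ connected A.

Definition C1_on (V : normedModType R) (U : set (R * R)) (g : R * R -> V) :=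
  forall v, v = (1, 0) \/ v = (0, 1) ->
  forall z, U z -> derivable g z v /\ {for z, continuous ('D_v g)}.

(* f_I is read as the function (x, y) |-> f (x + y I) on the open subset of
   R * R corresponding to Omega_I.  The values of f : H -> H outside Omega are
   irrelevant. *)
Definition slice_regular Omega f :=
  forall I, imag_units I ->
  let U := slice_point I @^-1` Omega in
  let fI := f \o slice_point I in
  C1_on U fI /\
  forall z, U z -> 2^-1 *: ('D_(1, 0) fI z + I * 'D_(0, 1) fI z) = 0.

Definition slice_domain Omega :=
  [/\ domain Omega,
      exists x : R, Omega x%:A
    & forall I, imag_units I ->
        @open (subspace (slice I)) (Omega `&` slice I) /\
        connected (Omega `&` slice I)].

Definition axially_symmetric C :=
  forall (x y : R) I, imag_units I -> C (slice_point I (x, y)) ->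
  sphere x y `<=` C.

Definition degenerate_set Omega f : set H :=
  [set q | exists x y : R,
    [/\ y != 0, sphere x y `<=` Omega,
        (forall p p', sphere x y p -> sphere x y p' -> f p = f p')
      & sphere x y q]].

End SliceRegular.

(* The restriction of f to A (with the subspace topology) is an open map. *)
Definition open_map_on (S T : topologicalType) (A : set S) (f : S -> T) :=
  forall U : set S, U `<=` A -> @open (subspace A) U -> open (f @` U).

(* Main.v *)
Require Import Defs.
From mathcomp Require Import complex finmap ring lra.

(** The restrictions of f to the slices fit together: there are quaternion
valued functions b and c of (x, y) with f(x + yJ) = b(x, y) + J c(x, y) for every
imaginary unit J, and b + ic is holomorphic in x + iy, coordinate by coordinate
([representation], [sdiff_stem]). To solve f(x + yJ) = p is to solve
J c = p - b, and this can be done with an imaginary unit J exactly when p - b and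
c have the same length and are orthogonal, that is, when the complex number
N_p(z) = sum_k (b_k + i c_k - p_k)^2 vanishes at z = x + iy ([norm_stemE],
[norm_stem_zero]). So points of the fibre of p are governed by the zeros of N_p,
a scalar holomorphic function depending continuously on p.

Let f(q0) = p0, with q0 = x0 + y0 I outside the closure of the degenerate set. Then
N_p0 vanishes at z0 = x0 + i y0, but not on a neighbourhood of z0: otherwise it
would vanish on the real points of the domain, where c = 0, hence b = p0 there, the
stem would be constant and all spheres degenerate ([not_locally_zero]). By Hurwitz'
theorem ([hurwitz]), N_p has a zero z near z0 for all p near p0, which gives a
solution q = x + yJ of f(q) = p. If q0 is real, q is close to q0 whatever J is; if
not, c(z0) is not 0, because the sphere of q0 is not degenerate, and
J = (p - b(z)) c(z)^-1 is close to I by continuity ([nbhs_image]).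

The one-variable theory behind this (the identity principle, isolated zeros and
Hurwitz' theorem) is derived from the maximum principle ([max_modulus]), and the
latter from a mean value property over roots of unity ([mean_value_approx]); neither
integrals nor power series are used. Isolation of zeros comes from dividing the
square of the function by a polynomial with many of its zeros
([many_zeros_bound]). *)

Set Implicit Arguments.
Unset Strict Implicit.
Unset Printing Implicit Defensive.

Import Order.TTheory GRing.Theory Num.Theory.
Import ComplexField Normc.

Local Open Scope classical_set_scope.
Local Open Scope ring_scope.

(* Unqualified, Re and Im are the ones of numeric closed fields. *)
Local Notation Re := complex.Re.
Local Notation Im := complex.Im.

(** * The modulus of complex numbers *)
Section ComplexModulus.
Variable R : realType.
Local Notation C := R[i].
Implicit Types (x y : C).

Lemma normcD x y : normc (x + y) <= normc x + normc y.
Proof. exact: le_normcD. Qed.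

Lemma normcB x y : normc (x - y) <= normc x + normc y.
Proof. by rewrite -(normcN y); exact: normcD. Qed.

Lemma normc_distC x y : normc (x - y) = normc (y - x).
Proof. by rewrite -(normcN (y - x)); congr normc; ring. Qed.

Lemma normc_ge0 x : 0 <= normc x.
Proof. by case: x => a b; exact: sqrtr_ge0. Qed.

Lemma sqr_normcE x : normc x ^+ 2 = Re x ^+ 2 + Im x ^+ 2.
Proof. by case: x => a b; rewrite /= sqr_sqrtr// addr_ge0 ?sqr_ge0. Qed.

Lemma normc_dist x y : `|normc x - normc y| <= normc (x - y).
Proof.
have hx := normcD (x - y) y; have hy := normcD (y - x) x.
rewrite subrK in hx; rewrite subrK (normc_distC y) in hy.
by rewrite ler_norml; apply/andP; split; lra.
Qed.

Lemma normc_Re x : `|Re x| <= normc x.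
Proof.
by case: x => a b; rewrite /= -sqrtr_sqr ler_wsqrtr// lerDl sqr_ge0.
Qed.

Lemma normc_Im x : `|Im x| <= normc x.
Proof.
by case: x => a b; rewrite /= -sqrtr_sqr ler_wsqrtr// lerDr sqr_ge0.
Qed.

Lemma normc_le_ReIm x : normc x <= `|Re x| + `|Im x|.
Proof.
rewrite -ler_sqr ?nnegrE ?normc_ge0 ?addr_ge0//.
rewrite sqr_normcE sqrrD !real_normK ?num_real// addrAC lerDl.
by rewrite mulrn_wge0// mulr_ge0.
Qed.

Lemma normc_eq0 x : (normc x == 0) = (x == 0).
Proof. by apply/eqP/eqP => [/eq0_normc|->]; rewrite ?normc0. Qed.

Lemma normc_gt0 x : (0 < normc x) = (x != 0).
Proof. by rewrite lt_def normc_ge0 andbT normc_eq0. Qed.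

Lemma normcX x n : normc (x ^+ n) = normc x ^+ n.
Proof.
by elim: n => [|n IH]; rewrite ?expr0 ?normc1// !exprS normcM IH.
Qed.

Lemma normc_sum (I : Type) (s : seq I) (P : pred I) (f : I -> C) :
  normc (\sum_(i <- s | P i) f i) <= \sum_(i <- s | P i) normc (f i).
Proof.
elim/big_rec2: _ => [|i a b _ h]; first by rewrite normc0.
by apply: le_trans (normcD _ _) _; rewrite lerD2l.
Qed.

Lemma normc_real (a : R) : normc (Complex a 0) = `|a|.
Proof. by rewrite /= expr0n addr0 sqrtr_sqr. Qed.

Lemma ReD x y : Re (x + y) = Re x + Re y.
Proof. by case: x y => [a b] [c d]. Qed.

Lemma ImD x y : Im (x + y) = Im x + Im y.
Proof. by case: x y => [a b] [c d]. Qed.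

Lemma ReN x : Re (- x) = - Re x. Proof. by case: x. Qed.
Lemma ImN x : Im (- x) = - Im x. Proof. by case: x. Qed.

Lemma Re_sum (I : Type) (s : seq I) (P : pred I) (f : I -> C) :
  Re (\sum_(i <- s | P i) f i) = \sum_(i <- s | P i) Re (f i).
Proof. by elim/big_rec2: _ => [//|i a b _ <-]; rewrite ReD. Qed.

Definition toC (z : R * R) : C := Complex z.1 z.2.
Definition ofC (x : C) : R * R := (Re x, Im x).

Lemma toCD z w : toC (z + w) = toC z + toC w. Proof. by []. Qed.
Lemma toCB z w : toC (z - w) = toC z - toC w. Proof. by []. Qed.
Lemma ofCK : cancel ofC toC. Proof. by case. Qed.

Lemma norm_le_toC z : `|z| <= normc (toC z).
Proof.
by rewrite prod_normE ge_max (normc_Re (toC z)) (normc_Im (toC z)).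
Qed.

Lemma normr1_le (z : R * R) : `|z.1| <= `|z|.
Proof. by rewrite prod_normE le_max lexx. Qed.

Lemma normr2_le (z : R * R) : `|z.2| <= `|z|.
Proof. by rewrite prod_normE le_max lexx orbT. Qed.

Lemma toC_le_norm z : normc (toC z) <= 2 * `|z|.
Proof.
rewrite mulr_natl mulr2n; apply: le_trans (normc_le_ReIm _) _.
by apply: lerD; [exact: normr1_le|exact: normr2_le].
Qed.

End ComplexModulus.

(** * Strict complex differentiability *)
Lemma near_right0 (R : realType) (P : R -> Prop) :
  (\forall r \near 0^'+, P r) -> exists2 r, 0 < r & P r.
Proof.
move=> nP; near (0 : R)^'+ => r; exists r; last exact: (near nP r).
by near: r; exact: nbhs_right_gt.
Unshelve. all: by end_near. Qed.

Section StrictDerivative.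
Variable R : realType.
Local Notation C := R[i].
Implicit Types (F G : R * R -> C) (a z w : R * R).

(** The derivative is required to be strict: the difference quotient converges
as both points move. At all points of an open set this is the same as being
holomorphic with a continuous derivative, but it is a condition at one point
and it mentions no derivative function, so that it passes to sums, products
and inverses without any bookkeeping. *)
Definition sdiff F a := exists d : C, forall e : R, 0 < e ->
  \forall r \near 0^'+, forall z w, `|z - a| < r -> `|w - a| < r ->
    normc (F z - F w - d * toC (z - w)) <= e * normc (toC (z - w)).

Lemma sdiff_lip F a : sdiff F a -> exists2 L : R, 0 < L &
  \forall r \near 0^'+, forall z w, `|z - a| < r -> `|w - a| < r ->
    normc (F z - F w) <= L * normc (toC (z - w)).
Proof.
move=> [d Fd]; exists (1 + normc d); first by have := normc_ge0 d; lra.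
have F1 := Fd 1 ltr01; near=> r => z w zr wr.
have -> : F z - F w = (F z - F w - d * toC (z - w)) + d * toC (z - w) by ring.
apply: le_trans (normcD _ _) _; rewrite mulrDl normcM lerD2r.
exact: (near F1 r).
Unshelve. all: by end_near. Qed.

Lemma sdiff_near F a (e : R) : sdiff F a -> 0 < e ->
  \forall r \near 0^'+, forall z, `|z - a| < r -> normc (F z - F a) <= e.
Proof.
move=> /sdiff_lip[L L0 FL] e0; near=> r => z zr.
have r0 : 0 < r by near: r; exact: nbhs_right_gt.
have ar : `|a - a| < r by rewrite subrr normr0.
apply: le_trans (_ : L * normc (toC (z - a)) <= _).
  exact: (near FL r).
apply: le_trans (_ : L * (2 * r) <= _).
  rewrite ler_pM2l//; apply: le_trans (toC_le_norm _) _.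
  by rewrite ler_pM2l// ltW.
rewrite mulrA -ler_pdivlMl ?mulr_gt0//.
by near: r; apply: nbhs_right_le; rewrite mulr_gt0// invr_gt0 mulr_gt0.
Unshelve. all: by end_near. Qed.

Lemma sdiff_cst a (x : C) : sdiff (fun=> x) a.
Proof.
exists 0 => e e0; near=> r => z w _ _.
by rewrite subrr mul0r subrr normc0 mulr_ge0// ?normc_ge0// ltW.
Unshelve. all: by end_near. Qed.

Lemma sdiff_toC a : sdiff (@toC R) a.
Proof.
exists 1 => e e0; near=> r => z w _ _.
by rewrite mul1r toCB subrr normc0 mulr_ge0// ?normc_ge0// ltW.
Unshelve. all: by end_near. Qed.

Lemma sdiffD F G a : sdiff F a -> sdiff G a -> sdiff (fun z => F z + G z) a.
Proof.
move=> [d Fd] [d' Gd]; exists (d + d') => e e0.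
have e20 : 0 < e / 2 by lra.
have F1 := Fd _ e20; have G1 := Gd _ e20.
near=> r => z w zr wr.
have -> : F z + G z - (F w + G w) - (d + d') * toC (z - w) =
  (F z - F w - d * toC (z - w)) + (G z - G w - d' * toC (z - w)) by ring.
apply: le_trans (normcD _ _) _; rewrite (splitr e) mulrDl.
by apply: lerD; [exact: (near F1 r)|exact: (near G1 r)].
Unshelve. all: by end_near. Qed.

(** With h the increment, the error splits as
(dF error) G(z) + F(w) (dG error) + d h (G(z) - G(a)) + (F(w) - F(a)) d' h. *)
Lemma sdiffM F G a : sdiff F a -> sdiff G a -> sdiff (fun z => F z * G z) a.
Proof.
move=> sF sG; have [[d Fd] [d' Gd]] := (sF, sG).
exists (d * G a + F a * d') => e e0.
pose K := normc (G a) + normc (F a) + normc d + normc d' + 2.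
have [nG nF nd nd'] : [/\ 0 <= normc (G a), 0 <= normc (F a), 0 <= normc d
  & 0 <= normc d'] by split; exact: normc_ge0.
have K0 : 0 < K by rewrite /K; lra.
pose e' := Num.min 1 (e / K).
have e'0 : 0 < e' by rewrite lt_min ltr01 divr_gt0.
have F1 := Fd _ e'0; have G1 := Gd _ e'0.
have F2 := sdiff_near sF e'0; have G2 := sdiff_near sG e'0.
near=> r => z w zr wr.
have f1 : normc (F z - F w - d * toC (z - w)) <= e' * normc (toC (z - w)).
  exact: (near F1 r).
have g1 : normc (G z - G w - d' * toC (z - w)) <= e' * normc (toC (z - w)).
  exact: (near G1 r).
have f2 : normc (F w - F a) <= e' by exact: (near F2 r).
have g2 : normc (G z - G a) <= e' by exact: (near G2 r).
set h := toC _ in f1 g1 *.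
have e'1 : e' <= 1 by rewrite ge_min lexx.
have g3 : normc (G z) <= normc (G a) + 1.
  have -> : G z = G a + (G z - G a) by ring.
  by apply: le_trans (normcD _ _) _; rewrite lerD2l (le_trans g2).
have f3 : normc (F w) <= normc (F a) + 1.
  have -> : F w = F a + (F w - F a) by ring.
  by apply: le_trans (normcD _ _) _; rewrite lerD2l (le_trans f2).
have -> : F z * G z - F w * G w - (d * G a + F a * d') * h =
  ((F z - F w - d * h) * G z + F w * (G z - G w - d' * h)) +
  (d * h * (G z - G a) + (F w - F a) * (d' * h)) by ring.
apply: (@le_trans _ _ (e' * K * normc h)); last first.
  by rewrite ler_wpM2r ?normc_ge0// -ler_pdivlMr// ge_min lexx orbT.
have -> : e' * K * normc h =
  ((e' * normc h) * (normc (G a) + 1) + (normc (F a) + 1) * (e' * normc h))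
  + (normc d * normc h * e' + e' * (normc d' * normc h)).
  by rewrite /K; ring.
have nh := normc_ge0 h.
do 2![apply: le_trans (normcD _ _) _; apply: lerD]; rewrite !normcM.
- by apply: ler_pM => //; exact: normc_ge0.
- by apply: ler_pM => //; exact: normc_ge0.
- by apply: ler_wpM2l => //; apply: mulr_ge0.
- by apply: ler_wpM2r => //; apply: mulr_ge0.
Unshelve. all: by end_near. Qed.

(** Over the common denominator F(z) F(w) F(a)^2, which is at least
|F(a)|^4 / 4 in modulus near a, the error is linear in the error of F and in
F(z) - F(a), F(w) - F(a). *)
Lemma sdiffV F a : sdiff F a -> F a != 0 -> sdiff (fun z => (F z)^-1) a.
Proof.
move=> sF Fa0; have [d Fd] := sF.
exists (- d / F a ^+ 2) => e e0.
set m := normc (F a); have m0 : 0 < m by rewrite normc_gt0.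
have nd := normc_ge0 d.
pose K := m ^+ 2 + 3 * m * normc d + 1.
have K0 : 0 < K.
  have h1 := sqr_ge0 m.
  have h2 : 0 <= 3 * m * normc d by rewrite !mulr_ge0// ltW.
  by rewrite /K; lra.
have e'0 : 0 < Num.min (m / 2) (e * (m ^+ 4 / 4) / K).
  by rewrite lt_min !divr_gt0 ?mulr_gt0 ?divr_gt0 ?exprn_gt0.
set e' := Num.min _ _ in e'0.
have F1 := Fd _ e'0; have F2 := sdiff_near sF e'0.
near=> r => z w zr wr.
have f1 : normc (F z - F w - d * toC (z - w)) <= e' * normc (toC (z - w)).
  exact: (near F1 r).
have fz : normc (F z - F a) <= e' by exact: (near F2 r).
have fw : normc (F w - F a) <= e' by exact: (near F2 r).
set h := toC _ in f1 *; have nh := normc_ge0 h.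
have e'm : e' <= m / 2 by rewrite ge_min lexx.
have lo x : normc (x - F a) <= e' -> m / 2 <= normc x.
  move=> xa; have : m <= normc x + normc (x - F a).
    have -> : m = normc (x - (x - F a)) by rewrite /m; congr normc; ring.
    exact: normcB.
  by lra.
have loz := lo _ fz; have low := lo _ fw.
have hiw : normc (F w) <= 2 * m.
  have -> : F w = F a + (F w - F a) by ring.
  apply: le_trans (normcD _ _) _; rewrite -/m.
  by lra.
have Fz0 : F z != 0 by rewrite -normc_gt0 (lt_le_trans _ loz)// divr_gt0.
have Fw0 : F w != 0 by rewrite -normc_gt0 (lt_le_trans _ low)// divr_gt0.
have -> : (F z)^-1 - (F w)^-1 - - d / F a ^+ 2 * h =
  (d * h * ((F z - F a) * F w + F a * (F w - F a)) -
   (F z - F w - d * h) * F a ^+ 2) / (F z * F w * F a ^+ 2).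
  by field; rewrite Fa0 Fz0 Fw0.
rewrite normcM normcV ler_pdivrMr; last first.
  by rewrite normc_gt0 !mulf_neq0 ?expf_neq0.
apply: (@le_trans _ _ (e' * K * normc h)).
  apply: le_trans (normcB _ _) _.
  have -> : e' * K * normc h = (normc d * normc h) * (e' * (2 * m) + m * e')
     + (e' * normc h) * m ^+ 2 + e' * normc h by rewrite /K; ring.
  rewrite -[leRHS]addrA; apply: lerD; last first.
    rewrite normcM normcX -/m ler_wpDr ?ler_wpM2r ?sqr_ge0//.
    by rewrite mulr_ge0// ltW.
  rewrite !normcM ler_wpM2l ?mulr_ge0//.
  apply: le_trans (normcD _ _) _; rewrite !normcM; apply: lerD.
    by apply: ler_pM => //; exact: normc_ge0.
  by rewrite ler_pM2l.
apply: (@le_trans _ _ (e * (m ^+ 4 / 4) * normc h)).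
  by rewrite ler_wpM2r// -ler_pdivlMr// ge_min lexx orbT.
rewrite mulrAC ler_wpM2l ?mulr_ge0 ?(ltW e0)// 2!normcM normcX -/m.
have -> : m ^+ 4 / 4 = (m / 2) * ((m / 2) * m ^+ 2) by field.
rewrite mulrA ler_wpM2r ?sqr_ge0// ler_pM// ?divr_ge0 ?(ltW m0)//.
Unshelve. all: by end_near. Qed.

Lemma sdiffX F a n : sdiff F a -> sdiff (fun z => F z ^+ n) a.
Proof.
move=> sF; elim: n => [|n IH]; first exact: sdiff_cst.
rewrite (_ : (fun z => _) = (fun z => F z * F z ^+ n)); first exact: sdiffM.
by apply/funext => z; rewrite exprS.
Qed.

Lemma sdiff_sum (I : Type) (s : seq I) (f : I -> R * R -> C) a :
  (forall i, sdiff (f i) a) -> sdiff (fun z => \sum_(i <- s) f i z) a.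
Proof.
move=> sf; elim: s => [|i s IH].
  rewrite (_ : (fun z => _) = fun=> 0); first exact: sdiff_cst.
  by apply/funext => z; rewrite big_nil.
rewrite (_ : (fun z => _) = fun z => f i z + \sum_(j <- s) f j z).
  exact: sdiffD.
by apply/funext => z; rewrite big_cons.
Qed.

Lemma sdiff_prod (I : Type) (s : seq I) (f : I -> R * R -> C) a :
  (forall i, sdiff (f i) a) -> sdiff (fun z => \prod_(i <- s) f i z) a.
Proof.
move=> sf; elim: s => [|i s IH].
  rewrite (_ : (fun z => _) = fun=> 1); first exact: sdiff_cst.
  by apply/funext => z; rewrite big_nil.
rewrite (_ : (fun z => _) = fun z => f i z * \prod_(j <- s) f j z).
  exact: sdiffM.
by apply/funext => z; rewrite big_cons.
Qed.

Lemma sdiff_continuous_normc F a :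
  sdiff F a -> {for a, continuous (fun z => normc (F z))}.
Proof.
move=> sF; apply/cvgrPdist_le => e e0.
have [r r0 hr] := near_right0 (sdiff_near sF e0).
near=> z; have zr : `|z - a| < r.
  by rewrite distrC; near: z; exact: cvgr_dist_lt.
apply: le_trans (hr z zr); rewrite normc_distC; exact: normc_dist.
Unshelve. all: by end_near. Qed.

End StrictDerivative.

(** * The mean value property *)
Lemma geometric_small (R : realType) (q e : R) : 0 <= q < 1 -> 0 < e ->
  exists n, q ^+ n < e.
Proof.
move=> /andP[q0 q1] e0.
have /cvgrPdist_lt/(_ _ e0)[n _ /(_ n (leqnn n))] : q ^+ n @[n --> \oo] --> 0.
  by apply: cvg_expr; rewrite ger0_norm.
by rewrite sub0r normrN ger0_norm ?exprn_ge0// => h; exists n.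
Qed.

Section MeanValue.
Variable R : realType.
Local Notation C := R[i].
Implicit Types (F G : R * R -> C) (a z w : R * R).
Local Notation rc := (real_complex R).

(** Repeated square roots of -1, taken with nonnegative real part: from
w - 1 = (s + 1) (s - 1) and |s + 1|^2 >= 2, each root at least halves |w - 1|^2. *)
Lemma root_of_unity_near1 (e : R) : 0 < e -> exists n (w : C),
  [/\ (0 < n)%N, w ^+ n = 1, w != 1, normc w = 1 & normc (w - 1) < e].
Proof.
move=> e0.
have halving m : exists w : C, [/\ w ^+ (2 ^ m.+1) = 1, w != 1, normc w = 1
    & normc (w - 1) ^+ 2 <= 4 * 2^-1 ^+ m].
  elim: m => [|m [w [wn w1 nw w_near1]]].
    exists (-1); rewrite sqrrN expr1n normcN normc1; split=> //.
      by rewrite -subr_eq0 -opprD oppr_eq0 -mulr2n pnatr_eq0.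
    rewrite expr0 mulr1 -opprD normcN sqr_normcE.
    rewrite -[1 + 1]/(Complex (1 + 1) (0 + 0)) /=.
    by lra.
  have s2 := sqr_sqrtc w; set s := sqrtc w in s2.
  have Re_s : 0 <= Re s by rewrite /s; case: (w) => a b; exact: sqrtr_ge0.
  have ns : normc s = 1.
    apply/eqP; rewrite -(@eqrXn2 _ 2) ?normc_ge0//.
    by rewrite -normcX s2 nw expr1n.
  exists s; split=> //.
  - by rewrite expnS exprM s2.
  - by apply: contra_neq w1 => s1; rewrite -s2 s1 expr1n.
  have : 2 * normc (s - 1) ^+ 2 <= normc (w - 1) ^+ 2.
    have -> : w - 1 = (s + 1) * (s - 1) by rewrite -s2; ring.
    rewrite normcM exprMn ler_wpM2r ?sqr_ge0//.
    have := sqr_normcE s; rewrite ns sqr_normcE ReD ImD /= => h.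
    by move: (Re s) (Im s) Re_s h => a b a0 h; nra.
  by rewrite [2^-1 ^+ _]exprS; lra.
have [m me] : exists m, (2^-1 : R) ^+ m < e ^+ 2 / 4.
  by apply: geometric_small; [lra|rewrite divr_gt0 ?exprn_gt0].
have [w [wn w1 nw hw]] := halving m; exists (2 ^ m.+1)%N, w.
split=> //; first by rewrite expn_gt0.
rewrite -ltr_sqr ?nnegrE ?normc_ge0 ?(ltW e0)//.
by move: hw me; set x := normc _ ^+ 2; lra.
Qed.

(** On a compact set the radius in strict differentiability can be taken
uniform, although the derivative still depends on the centre: this is the
Lebesgue number argument. *)
Lemma sdiff_uniform F (K : set (R * R)) (e : R) : compact K ->
    (forall a, K a -> sdiff F a) -> 0 < e ->
  exists2 r, 0 < r & forall a, K a -> exists d : C,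
    forall z w, `|z - a| < r -> `|w - a| < r ->
      normc (F z - F w - d * toC (z - w)) <= e * normc (toC (z - w)).
Proof.
move=> /compact_near_coveringP cK sF e0.
apply: near_right0; apply: cK => a Ka.
have [d /(_ e e0)/near_right0[r r0 dP]] := sF a Ka.
have r20 : 0 < r / 2 by rewrite divr_gt0.
near=> b i => /=; exists d => z w zb wb.
have ba : `|b - a| < r / 2 by rewrite distrC; near: b; exact: cvgr_dist_lt.
have ir : i < r / 2 by near: i; exact: nbhs_right_lt.
by apply: dP; rewrite -[_ - a](subrKA b) (le_lt_trans (ler_normD _ _))//; lra.
Unshelve. all: by end_near. Qed.

Lemma compact_square (z0 : R * R) (r : R) :
  compact [set z : R * R | `|z - z0| <= r].
Proof.
have -> : [set z : R * R | `|z - z0| <= r] =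
    `[z0.1 - r, z0.1 + r]%classic `*` `[z0.2 - r, z0.2 + r]%classic.
  apply/seteqP; split=> z; rewrite /= !in_itv /= -!ler_distlC prod_normE ge_max;
  by rewrite (distrC z0.1) (distrC z0.2) => /andP.
by apply: compact_setX; exact: segment_compact.
Qed.

(** A discrete form of the mean value property, which avoids integrals. Let
S_j be the sum of F over the points z1 + t_j w^k of a fine polar grid, w being
an n-th root of unity close to 1. Passing from the radius t_j to t_(j+1)
changes S_j by about (t_(j+1) - t_j) times the sum of F'(z_jk) w^k. The same
sum, multiplied by t_j (w - 1), approximates the sum over k of
F(z_j(k+1)) - F(z_jk), which telescopes to 0 around the circle; so it is
negligible and S_j hardly moves away from S_0 = n F(z1). *)
Lemma mean_value_approx F (z1 : R * R) (rho e : R) : 0 < rho -> 0 < e ->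
    (forall a, `|a - z1| <= rho -> sdiff F a) ->
  exists n (w : C), [/\ (0 < n)%N, normc w = 1 &
    normc (\sum_(0 <= k < n) F (z1 + ofC (rc rho * w ^+ k)) - F z1 *+ n)
      <= n%:R * e].
Proof.
move=> rho0 e0 sF.
(* Each of the M radial steps will cost at most 2 n e' rho / M. *)
pose e' := e / (2 * rho); have e'0 : 0 < e' by rewrite divr_gt0 ?mulr_gt0.
have [r r0 hr] := sdiff_uniform (@compact_square z1 rho) sF e'0.
have /choice[d dP] : forall a, exists d : C, `|a - z1| <= rho ->
    forall z w, `|z - a| < r -> `|w - a| < r ->
      normc (F z - F w - d * toC (z - w)) <= e' * normc (toC (z - w)).
  move=> a; have [h|_] := boolP (`|a - z1| <= rho); last by exists 0.
  by have [d dP] := hr a h; exists d.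
have [n [w [n0 wn w1 nw w_near1]]] := root_of_unity_near1 (divr_gt0 r0 rho0).
have [M Mr] : exists M : nat, rho / r < M%:R.
  by exists (Num.bound (rho / r)); rewrite archi_boundP// divr_ge0 ?ltW.
have M0 : 0 < M%:R :> R by apply: le_lt_trans Mr; rewrite divr_ge0 ?ltW.
exists n, w; split=> //.
have nwk k : normc (w ^+ k) = 1 by rewrite normcX nw expr1n.
pose t j : R := rho / M%:R * j%:R.
have st0 : 0 <= rho / M%:R by rewrite divr_ge0 ?(ltW rho0) ?(ltW M0).
have t_ge0 j : 0 <= t j by rewrite /t !mulr_ge0 ?invr_ge0 ?(ltW rho0) ?(ltW M0).
have t_le j : (j <= M)%N -> t j <= rho.
  move=> jM; rewrite /t -mulrA ler_piMr ?(ltW rho0)// mulrC ler_pdivrMr//.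
  by rewrite mul1r ler_nat.
have nrc (x : R) : 0 <= x -> normc (rc x) = x.
  by move=> x0; rewrite normc_real ger0_norm.
pose pt j k := z1 + ofC (rc (t j) * w ^+ k).
have ptn j : pt j n = pt j 0%N by rewrite /pt wn expr0.
have toC_pt j k : toC (pt j k) = toC z1 + rc (t j) * w ^+ k.
  by rewrite /pt toCD ofCK.
have stepj j k : toC (pt j.+1 k - pt j k) = rc (rho / M%:R) * w ^+ k.
  rewrite toCB !toC_pt (_ : t j.+1 = t j + rho / M%:R); last first.
    by rewrite /t -natr1 mulrDr mulr1.
  by rewrite rmorphD; ring.
have stepk j k : toC (pt j k.+1 - pt j k) = rc (t j) * (w - 1) * w ^+ k.
  by rewrite toCB !toC_pt exprS; ring.
have pt_in j k : (j <= M)%N -> `|pt j k - z1| <= rho.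
  move=> jM; apply: le_trans (norm_le_toC _) _.
  rewrite toCB toC_pt addrC addKr normcM nwk mulr1 nrc//.
  exact: t_le.
have ptpt j k : `|pt j k - pt j k| < r by rewrite subrr normr0.
have dj j k : (j < M)%N -> normc (F (pt j.+1 k) - F (pt j k)
    - d (pt j k) * (rc (rho / M%:R) * w ^+ k)) <= e' * (rho / M%:R).
  move=> jM; have := dP _ (pt_in j k (ltnW jM)) (pt j.+1 k) (pt j k).
  rewrite stepj normcM nwk mulr1 nrc//; apply=> //.
  apply: le_lt_trans (norm_le_toC _) _.
  rewrite stepj normcM nwk mulr1 nrc//.
  by rewrite ltr_pdivrMr// mulrC -ltr_pdivrMr.
have dk j k : (j <= M)%N -> normc (F (pt j k.+1) - F (pt j k)
    - d (pt j k) * (rc (t j) * (w - 1) * w ^+ k)) <= e' * (t j * normc (w - 1)).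
  move=> jM; have := dP _ (pt_in j k jM) (pt j k.+1) (pt j k).
  rewrite stepk !normcM nwk mulr1 nrc//; apply=> //.
  apply: le_lt_trans (norm_le_toC _) _.
  rewrite stepk !normcM nwk mulr1 nrc//.
  apply: le_lt_trans (_ : rho * normc (w - 1) < r).
    by rewrite ler_wpM2r ?normc_ge0 ?t_le.
  by rewrite mulrC -ltr_pdivlMr.
have d_avg j : (j <= M)%N ->
    normc (\sum_(0 <= k < n) d (pt j k) * w ^+ k) <= n%:R * e'.
  (* At radius 0 the telescoping argument is void, but there d is constant and
     the sum of the powers of w is 0. *)
  move=> jM; have [tj0|tj0] := eqVneq (t j) 0.
    have -> : \sum_(0 <= k < n) d (pt j k) * w ^+ k = 0.
      under eq_bigr => k _ do rewrite /pt tj0 mul0r.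
      rewrite -mulr_sumr; suff -> : \sum_(0 <= k < n) w ^+ k = 0 by rewrite mulr0.
      apply: (mulfI (_ : w - 1 != 0)); first by rewrite subr_eq0.
      by rewrite big_mkord -subrX1 wn subrr mulr0.
    by rewrite normc0 mulr_ge0 ?(ltW e'0).
  have c0 : 0 < t j * normc (w - 1).
    by rewrite mulr_gt0 ?normc_gt0 ?subr_eq0// lt_def tj0 t_ge0.
  rewrite -(ler_pM2l c0).
  have -> : t j * normc (w - 1) * normc (\sum_(0 <= k < n) d (pt j k) * w ^+ k)
     = normc (\sum_(0 <= k < n) (F (pt j k.+1) - F (pt j k)
    - d (pt j k) * (rc (t j) * (w - 1) * w ^+ k))).
    rewrite sumrB (telescope_sumr (fun k => F (pt j k)))// ptn subrr sub0r.
    rewrite normcN -[t j in LHS]nrc// -!normcM; congr normc.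
    by rewrite mulr_sumr; apply: eq_bigr => k _; ring.
  apply: le_trans (normc_sum _ _ _) _.
  apply: (@le_trans _ _ (\sum_(0 <= k < n) e' * (t j * normc (w - 1)))).
    by apply: ler_sum => k _; exact: dk.
  by rewrite sumr_const_nat subn0 -mulr_natl; lra.
pose S j := \sum_(0 <= k < n) F (pt j k).
have SS j : (j < M)%N -> normc (S j.+1 - S j) <= n%:R * e / M%:R.
  move=> jM; have -> : S j.+1 - S j =
    \sum_(0 <= k < n) (F (pt j.+1 k) - F (pt j k)
    - d (pt j k) * (rc (rho / M%:R) * w ^+ k)) +
    rc (rho / M%:R) * \sum_(0 <= k < n) d (pt j k) * w ^+ k.
    rewrite /S -sumrB mulr_sumr -big_split /=; apply: eq_bigr => k _; ring.
  apply: le_trans (normcD _ _) _.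
  apply: (@le_trans _ _ (n%:R * (e' * (rho / M%:R)) + rho / M%:R * (n%:R * e'))).
    apply: lerD; last first.
      rewrite normcM nrc// ler_pM2l ?divr_gt0//.
      exact/d_avg/ltnW.
    apply: le_trans (normc_sum _ _ _) _.
    rewrite mulr_natl -[n in leRHS]subn0 -sumr_const_nat.
    by apply: ler_sum => k _; exact: dj.
  rewrite /e' le_eqVlt; apply/orP; left; apply/eqP; field.
  by rewrite !gt_eqF.
have -> : \sum_(0 <= k < n) F (z1 + ofC (rc rho * w ^+ k)) = S M.
  by rewrite /S /pt /t divfK// gt_eqF.
have -> : F z1 *+ n = S 0.
  rewrite /S -[n in LHS]subn0 -sumr_const_nat; apply: eq_bigr => k _.
  by rewrite /pt /t mulr0 rmorph0 mul0r addr0.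
have -> : S M - S 0 = \sum_(0 <= j < M) (S j.+1 - S j).
  by rewrite telescope_sumr.
apply: le_trans (normc_sum _ _ _) _.
apply: (@le_trans _ _ (\sum_(0 <= j < M) n%:R * e / M%:R)).
  by rewrite !big_nat; apply: ler_sum => j /SS.
by rewrite sumr_const_nat subn0 -[leLHS]mulr_natr divfK ?gt_eqF.
Qed.

(** A mean cannot be approached if all the values averaged stay well below
it. *)
Lemma mean_value_ge F (z1 : R * R) (rho e : R) : 0 < rho -> 0 < e ->
    (forall a, `|a - z1| <= rho -> sdiff F a) ->
  exists2 z, normc (toC (z - z1)) = rho & Re (F z1) - e <= Re (F z).
Proof.
move=> rho0 e0 sF; have [n [w [n0 nw avg]]] := mean_value_approx rho0 e0 sF.
apply: contrapT => /forall2NP small.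
have lt k : Re (F (z1 + ofC (rc rho * w ^+ k))) < Re (F z1) - e.
  have [|/negP] := small (z1 + ofC (rc rho * w ^+ k)); last by rewrite -ltNge.
  rewrite addrC addKr ofCK normcM normcX nw expr1n mulr1 normc_real.
  by rewrite gtr0_norm.
have : Re (\sum_(0 <= k < n) F (z1 + ofC (rc rho * w ^+ k)) - F z1 *+ n)
   < - (n%:R * e).
  rewrite ReD ReN Re_sum -[n in F z1 *+ n]subn0 -sumr_const_nat Re_sum -sumrB.
  rewrite -mulrN mulr_natl -[n in ltRHS]subn0 -sumr_const_nat.
  apply: ltr_sum_nat => // k _; have := lt k; lra.
have := normc_Re (\sum_(0 <= k < n) F (z1 + ofC (rc rho * w ^+ k)) - F z1 *+ n).
by move: avg; rewrite ler_norml => h /andP[h1 h2] h3; lra.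
Qed.

End MeanValue.

(** * The maximum modulus principle *)
Section MaximumPrinciple.
Variable R : realType.
Local Notation C := R[i].
Implicit Types (F G : R * R -> C) (a z w : R * R).

Lemma sdiff_toCB a z : sdiff (fun w => toC (w - a)) z.
Proof.
rewrite (_ : (fun w => _) = (fun w => toC w + - toC a)); last first.
  by apply/funext => w; rewrite toCB.
by apply: sdiffD; [exact: sdiff_toC|exact: sdiff_cst].
Qed.

(** The hypothesis of differentiability only where G does not vanish (as in
Rado's theorem) allows quotients with zeros in the denominator as long as they
extend by 0. If |G(w)| > M, perturb |G|^2 by a small multiple of |z - z0|^2,
so that it still has its maximum at an interior point z1, and linearize: the
real part of a function differentiable near z1 would lie below its value at z1
by at least eps rho^2 on each small circle of radius rho, against the mean value
property. *)
Lemma max_modulus G z0 (r M : R) : 0 < r -> 0 <= M ->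
    (forall z, `|z - z0| <= r -> {for z, continuous (fun w => normc (G w))}) ->
    (forall z, `|z - z0| < r -> G z != 0 -> sdiff G z) ->
    (forall z, `|z - z0| = r -> normc (G z) <= M) ->
  forall z, `|z - z0| <= r -> normc (G z) <= M.
Proof.
move=> r0 M0 cG sG GM w wr; rewrite leNgt; apply/negP => Mw.
have Mw2 : M ^+ 2 < normc (G w) ^+ 2.
  by rewrite ltr_sqr ?nnegrE ?normc_ge0.
have r2 : 0 < r ^+ 2 by rewrite exprn_gt0.
(* As |toC (z - z0)|^2 <= 4 r^2 on the square, the perturbation is at most half
   of |G w|^2 - M^2; so phi is too small for a maximum on the boundary or at
   a zero of G. *)
pose eps := (normc (G w) ^+ 2 - M ^+ 2) / (8 * r ^+ 2).
have eps0 : 0 < eps by rewrite divr_gt0 ?subr_gt0 ?mulr_gt0.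
have epsE : eps * (8 * r ^+ 2) = normc (G w) ^+ 2 - M ^+ 2.
  by rewrite divfK// gt_eqF ?mulr_gt0.
pose phi z := normc (G z) ^+ 2 + eps * normc (toC (z - z0)) ^+ 2.
have phi_le z : `|z - z0| <= r -> phi z <= normc (G z) ^+ 2 + eps * (4 * r ^+ 2).
  move=> zr; rewrite lerD2l ler_pM2l// (_ : 4 * r ^+ 2 = (2 * r) ^+ 2); last by ring.
  rewrite ler_sqr ?nnegrE ?normc_ge0 ?mulr_ge0 ?(ltW r0)//.
  by apply: le_trans (toC_le_norm _) _; rewrite ler_pM2l.
have [z1 z1r z1max] : exists2 c, c \in [set z | `|z - z0| <= r] &
    forall t, t \in [set z | `|z - z0| <= r] -> phi t <= phi c.
  apply: compact_EVT_max; [|exact: compact_square|].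
    by exists z0; rewrite /= subrr normr0 ltW.
  apply: continuous_in_subspaceT => z /set_mem /= zr.
  apply: cvgD; first exact: (cvgM (cG z zr) (cG z zr)).
  have cB := sdiff_continuous_normc (@sdiff_toCB z0 z).
  by apply: cvgM; [exact: cvg_cst|exact: (cvgM cB cB)].
move/set_mem: z1r => /= z1r.
have {}z1max z : `|z - z0| <= r -> phi z <= phi z1.
  by move=> zr; apply/z1max/mem_set.
have hw : normc (G w) ^+ 2 <= phi z1.
  apply: le_trans (z1max w wr); rewrite lerDl mulr_ge0 ?sqr_ge0 ?(ltW eps0)//.
have h1 := phi_le _ z1r.
have M20 : 0 <= M ^+ 2 by rewrite sqr_ge0.
have z1lt : `|z1 - z0| < r.
  rewrite lt_neqAle z1r andbT; apply/eqP => /GM z1M.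
  have : normc (G z1) ^+ 2 <= M ^+ 2 by rewrite ler_sqr ?nnegrE ?normc_ge0.
  by lra.
have Gz1 : G z1 != 0.
  by apply/eqP => Gz10; rewrite Gz10 normc0 expr0n /= in h1; lra.
have n1 : 0 < normc (G z1) / 2 by rewrite divr_gt0 ?normc_gt0.
have [r' r'0 hr'] := near_right0 (sdiff_near (sG _ z1lt Gz1) n1).
pose rho := Num.min (r' / 2) ((r - `|z1 - z0|) / 2).
have rho0 : 0 < rho by rewrite lt_min !divr_gt0// subr_gt0.
have in_disc z : `|z - z1| <= rho -> `|z - z0| < r.
  rewrite le_min => /andP[_ h]; rewrite -(subrKA z1).
  by apply: le_lt_trans (ler_normD _ _) _; lra.
(* Re F is the linearization of phi at z1, in terms of G and z; what it leaves
   out, |G z - G z1|^2 + eps |z - z1|^2, is nonnegative and gives the strict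
   inequality. *)
pose F z := 2%:R * conjc (G z1) * G z
  + 2%:R * (Complex eps 0) * conjc (toC (z1 - z0)) * toC z.
have sF z : `|z - z1| <= rho -> sdiff F z.
  move=> zrho; apply: sdiffD; apply: sdiffM; try exact: sdiff_cst.
    apply: sG; first exact: in_disc.
    have zr' : `|z - z1| < r'.
      by move: zrho; rewrite le_min => /andP[h _]; lra.
    have := hr' z zr'; apply: contraTneq => ->.
    by rewrite sub0r normcN -ltNge; have := n1; lra.
  exact: sdiff_toC.
have erho : 0 < eps * rho ^+ 2 / 2.
  by apply: divr_gt0 => //; rewrite mulr_gt0 ?exprn_gt0.
have [z zrho] := mean_value_ge rho0 erho sF.
have zr : `|z - z0| <= r by apply/ltW/in_disc; rewrite -zrho norm_le_toC.
have := z1max z zr.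
have {zrho} : normc (toC (z - z1)) ^+ 2 = rho ^+ 2 by rewrite zrho.
have ReF u : Re (F u) = 2 * (Re (G z1) * Re (G u) + Im (G z1) * Im (G u))
    + 2 * eps * ((z1 - z0).1 * u.1 + (z1 - z0).2 * u.2).
  by rewrite /F; case: (G z1) (G u) => [p q] [a b]; rewrite /toC /=; ring.
rewrite /phi !sqr_normcE !ReF /=.
have := sqr_ge0 (Re (G z) - Re (G z1)); have := sqr_ge0 (Im (G z) - Im (G z1)).
by nra.
Qed.

(** Otherwise 1/F would violate the maximum principle. *)
Lemma min_modulus_zero F z0 (r m : R) : 0 < r -> 0 < m ->
    (forall z, `|z - z0| <= r -> sdiff F z) ->
    (forall z, `|z - z0| = r -> m <= normc (F z)) -> normc (F z0) < m ->
  exists2 z, `|z - z0| <= r & F z = 0.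
Proof.
move=> r0 m0 sF Fm; apply: contraPP => /forall2NP noz.
have F0 z : `|z - z0| <= r -> F z != 0.
  by move=> zr; have [/negP|/eqP] := noz z; rewrite ?zr.
have F00 : F z0 != 0 by apply: F0; rewrite subrr normr0 ltW.
apply/negP; rewrite -leNgt -lef_pV2 ?posrE ?normc_gt0// -normcV.
have sV z : `|z - z0| <= r -> sdiff (fun z => (F z)^-1) z.
  by move=> zr; apply: sdiffV; [exact: sF|exact: F0].
apply: (@max_modulus (fun z => (F z)^-1) z0 r) => //.
- by rewrite invr_ge0 ltW.
- by move=> z /sV /sdiff_continuous_normc.
- by move=> z zr _; apply: sV; exact: ltW.
- move=> z zr; rewrite normcV lef_pV2 ?posrE ?normc_gt0 ?F0 ?zr//.
  exact: Fm.
- by rewrite subrr normr0 ltW.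
Qed.

Lemma prod_le_exp (I : eqType) (s : seq I) (f : I -> R) (c : R) :
  (forall i, i \in s -> 0 <= f i <= c) -> \prod_(i <- s) f i <= c ^+ size s.
Proof.
move=> fc; suff /andP[] : 0 <= \prod_(i <- s) f i <= c ^+ size s by [].
elim: s fc => [|i s IH] fc; first by rewrite big_nil ler01 lexx.
have /andP[fi0 fic] := fc i (mem_head _ _).
have /andP[p0 pc] : 0 <= \prod_(j <- s) f j <= c ^+ size s.
  by apply: IH => j js; apply: fc; rewrite in_cons js orbT.
by rewrite big_cons exprS mulr_ge0//= ler_pM.
Qed.

Lemma exp_le_prod (I : eqType) (s : seq I) (f : I -> R) (c : R) : 0 <= c ->
  (forall i, i \in s -> c <= f i) -> c ^+ size s <= \prod_(i <- s) f i.
Proof.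
move=> c0; elim: s => [|i s IH] fc; first by rewrite big_nil.
rewrite big_cons exprS ler_pM ?exprn_ge0 ?fc ?mem_head//.
by apply: IH => j js; apply: fc; rewrite in_cons js orbT.
Qed.

(** Let P be the product of the z - a over the given zeros a. The function
F^2 / P is continuous, with value 0 at these zeros (where division by 0 gives
0), because F = O(z - a); so the maximum principle bounds it by its size on the
boundary, where |P| is at least (7r/8)^n, while |P| is at most (r/2)^n within
distance r/8 of z0. Dividing F^2 rather than F is what makes the quotient continuous without
knowing that F / (z - a) is differentiable at a. *)
Lemma many_zeros_bound F z0 (r M : R) (s : seq (R * R)) : 0 < r -> 0 <= M ->
    (forall z, `|z - z0| <= r -> sdiff F z) ->
    (forall z, `|z - z0| = r -> normc (F z) <= M) ->
    uniq s -> (forall a, a \in s -> `|a - z0| <= r / 8 /\ F a = 0) ->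
  forall z, `|z - z0| <= r / 8 ->
    normc (F z) ^+ 2 <= M ^+ 2 * (4 / 7) ^+ size s.
Proof.
move=> r0 M0 sF FM us sZ z zr.
pose P u : C := \prod_(a <- s) toC (u - a).
have sP u : sdiff P u by apply: sdiff_prod => a; exact: sdiff_toCB.
have toC0 u : (toC u == 0) = (u == 0).
  by case: u => x y; rewrite eq_complex.
have P0 u : P u = 0 -> u \in s.
  move=> /eqP; rewrite prodf_seq_eq0 => /hasP[a /= sa].
  by rewrite toC0 subr_eq0 => /eqP ->.
have normP u : normc (P u) = \prod_(a <- s) normc (toC (u - a)).
  rewrite /P; elim: (s) => [|a t IH]; first by rewrite !big_nil normc1.
  by rewrite !big_cons normcM IH.
have [Pz0|Pz0] := eqVneq (P z) 0.
  have [_ ->] := sZ z (P0 _ Pz0).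
  by rewrite normc0 expr0n mulr_ge0 ?sqr_ge0 ?exprn_ge0 ?divr_ge0.
pose G u := F u ^+ 2 / P u.
have bdry u : `|u - z0| = r -> (7 / 8 * r) ^+ size s <= normc (P u).
  move=> ur; rewrite normP; apply: exp_le_prod => [|a sa].
    by rewrite mulr_ge0 ?divr_ge0 ?(ltW r0).
  apply: le_trans (norm_le_toC _).
  have [ha _] := sZ a sa; have := ler_distD a u z0; rewrite ur; lra.
have rs0 : 0 < (7 / 8 * r) ^+ size s by rewrite exprn_gt0 ?mulr_gt0 ?divr_gt0.
have sG u : `|u - z0| <= r -> P u != 0 -> sdiff G u.
  move=> ur Pu; apply: sdiffM; first by apply: sdiffX; exact: sF.
  exact: sdiffV.
have cG u : `|u - z0| <= r -> {for u, continuous (fun w => normc (G w))}.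
  move=> ur; have [Pu|Pu] := eqVneq (P u) 0; last first.
    exact/sdiff_continuous_normc/sG.
  have su := P0 _ Pu; have [_ Fu] := sZ u su.
  (* The zeros in s are distinct, so P vanishes only to first order at u. *)
  pose Q w : C := \prod_(a <- rem u s) toC (w - a).
  have PE w : P w = toC (w - u) * Q w by rewrite /P (big_rem u).
  have Qu : Q u != 0.
    rewrite /Q prodf_seq_neq0; apply/allP => a /=; rewrite mem_rem_uniq//.
    by rewrite inE toC0 subr_eq0 eq_sym => /andP[].
  have sQ : sdiff Q u by apply: sdiff_prod => a; exact: sdiff_toCB.
  have Q20 : 0 < normc (Q u) / 2 by rewrite divr_gt0 ?normc_gt0.
  have [L L0 FL] := sdiff_lip (sF u ur).
  have FQ := sdiff_near sQ Q20.
  apply/cvgrPdist_le => e e0.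
  have Gu : normc (G u) = 0 by rewrite /G Fu expr0n mul0r normc0.
  have [rho rho0 near_u] : exists2 rho, 0 < rho & forall w, `|w - u| < rho ->
      normc (G w) <= e.
    apply: near_right0; near=> rho => w wrho.
    have rho0 : 0 < rho by near: rho; exact: nbhs_right_gt.
    have [->|wu] := eqVneq w u.
      by rewrite /G Fu expr0n mul0r normc0 ltW.
    have nwu : 0 < normc (toC (w - u)) by rewrite normc_gt0 toC0 subr_eq0.
    have h1 : normc (F w) <= L * normc (toC (w - u)).
      rewrite -[F w]subr0 -Fu; apply: (near FL rho) => //.
      by rewrite subrr normr0.
    have h2 : normc (Q w - Q u) <= normc (Q u) / 2 by exact: (near FQ rho).
    have h3 : normc (Q u) / 2 <= normc (Q w).
      have := normcB (Q w) (Q w - Q u); rewrite subKr; lra.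
    have Qw0 : 0 < normc (Q w) by lra.
    rewrite /G normcM normcX normcV PE normcM ler_pdivrMr ?mulr_gt0//.
    apply: (@le_trans _ _ ((L * normc (toC (w - u))) ^+ 2)).
      by rewrite ler_sqr ?nnegrE ?normc_ge0 ?mulr_ge0 ?normc_ge0 ?(ltW L0).
    have h4 : normc (toC (w - u)) <= e * (normc (Q u) / 2) / L ^+ 2.
      apply: le_trans (toC_le_norm _) _; rewrite mulrC -ler_pdivlMr//.
      apply/ltW/(lt_trans wrho); near: rho; apply: nbhs_right_lt.
      by apply: divr_gt0 => //; apply: divr_gt0; [apply: mulr_gt0|apply: exprn_gt0].
    rewrite ler_pdivlMr ?exprn_gt0// in h4.
    have h5 := ler_wpM2l (ltW nwu) h4.
    have h6 := ler_wpM2l (mulr_ge0 (ltW e0) (ltW nwu)) h3.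
    by move: h5 h6; set n := normc (toC _); set q := normc (Q w); lra.
  near=> w; rewrite Gu sub0r normrN ger0_norm ?normc_ge0//; apply: near_u.
  by rewrite distrC; near: w; exact: cvgr_dist_lt.
have GM u : `|u - z0| = r -> normc (G u) <= M ^+ 2 / (7 / 8 * r) ^+ size s.
  move=> ur; rewrite /G normcM normcV normcX.
  have := lt_le_trans rs0 (bdry u ur) => Pu0.
  rewrite ler_pM ?sqr_ge0 ?invr_ge0 ?normc_ge0//.
    by rewrite ler_sqr ?nnegrE ?normc_ge0 ?FM.
  by rewrite lef_pV2 ?posrE// bdry.
have zr' : `|z - z0| <= r by lra.
have := @max_modulus G z0 r _ r0 _ cG _ GM z zr'.
rewrite /G normcM normcV normcX => hz.
have {}hz : normc (F z) ^+ 2 / normc (P z) <= M ^+ 2 / (7 / 8 * r) ^+ size s.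
  apply: hz; first by rewrite divr_ge0 ?sqr_ge0 ?(ltW rs0).
  move=> u /ltW ur Gu; apply: sG => //; apply: contra_neq Gu.
  by move=> Pu; rewrite /G Pu invr0 mulr0.
have Pz_le : normc (P z) <= (r / 2) ^+ size s.
  rewrite normP; apply: prod_le_exp => a sa; rewrite normc_ge0 andTb.
  apply: le_trans (toC_le_norm _) _.
  have [ha _] := sZ a sa.
  by have := ler_distD z0 z a; rewrite (distrC z0 a); lra.
move: hz; rewrite ler_pdivrMr ?normc_gt0// => /le_trans; apply.
apply: (@le_trans _ _ (M ^+ 2 / (7 / 8 * r) ^+ size s * (r / 2) ^+ size s)).
  by rewrite ler_wpM2l// divr_ge0 ?sqr_ge0 ?(ltW rs0).
rewrite -mulrA ler_wpM2l ?sqr_ge0// mulrC -expr_div_n le_eqVlt.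
by apply/orP; left; apply/eqP; congr (_ ^+ _); field; rewrite gt_eqF.
Unshelve. all: by end_near. Qed.

End MaximumPrinciple.

(** * Isolated zeros and the identity principle *)
Section Identity.
Variable R : realType.
Local Notation C := R[i].
Implicit Types (F G : R * R -> C) (a z w : R * R).

Lemma nbhs_square z0 (A : set (R * R)) :
  nbhs z0 A <-> exists2 r, 0 < r & forall z, `|z - z0| <= r -> A z.
Proof.
have ballE (r : R) z : ball z0 r z = (`|z - z0| < r) :> Prop.
  by rewrite -ball_normE /ball_ /= distrC.
have [h1 h2] := @nbhs_ballP R (R * R)%type z0 A; split=> [/h1[r /= r0 rA]|].
  exists (r / 2); first by rewrite divr_gt0.
  by move=> z zr; apply: rA; rewrite ballE; lra.
move=> [r r0 rA]; apply: h2; exists r => //= z; rewrite ballE => zr.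
exact/rA/ltW.
Qed.

Lemma sdiff_bounded F z0 (r : R) : 0 < r ->
    (forall z, `|z - z0| <= r -> sdiff F z) ->
  exists2 M, 0 <= M & forall z, `|z - z0| <= r -> normc (F z) <= M.
Proof.
move=> r0 sF.
have [c _ hc] : exists2 c, c \in [set z | `|z - z0| <= r] &
    forall t, t \in [set z | `|z - z0| <= r] -> normc (F t) <= normc (F c).
  apply: compact_EVT_max; [|exact: compact_square|].
    by exists z0; rewrite /= subrr normr0 ltW.
  apply: continuous_in_subspaceT => z /set_mem /= zr.
  exact/sdiff_continuous_normc/sF.
exists (normc (F c)); first exact: normc_ge0.
by move=> z zr; apply/hc/mem_set.
Qed.

(** With infinitely many zeros in the small square, [many_zeros_bound] holds
with arbitrarily high powers of 4/7. This replaces the expansion in power series. *)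
Lemma zeros_isolated F z0 (r : R) : 0 < r ->
    (forall z, `|z - z0| <= r -> sdiff F z) ->
  (forall z, `|z - z0| <= r / 8 -> F z = 0) \/
  exists2 rho, 0 < rho & forall z, z != z0 -> `|z - z0| <= rho -> F z != 0.
Proof.
move=> r0 sF; pose Z := [set z | `|z - z0| <= r / 8 /\ F z = 0].
have [M M0 FM] := sdiff_bounded r0 sF.
have [finZ|infZ] := pselect (finite_set Z).
  right; have cZ : closed (Z `\ z0).
    apply: (accessible_finite_set_closed.1 _ _ (finite_setD _ finZ)).
    exact/hausdorff_accessible/norm_hausdorff.
  have [rho rho0 noZ] : exists2 rho, 0 < rho &
      forall z, `|z - z0| <= rho -> ~ (Z `\ z0) z.
    apply/nbhs_square; apply: open_nbhs_nbhs; split; first exact: closed_openC.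
    by move=> [_ /(_ erefl)].
  exists (Num.min rho (r / 8)).
    by rewrite lt_min rho0 divr_gt0.
  move=> z zz0; rewrite le_min => /andP[/noZ zrho zr].
  by apply/eqP => Fz; apply: zrho; split=> //; exact/eqP.
left=> z zr; apply/eqP; rewrite -normc_eq0 -sqrf_eq0 eq_le sqr_ge0 andbT.
rewrite leNgt; apply/negP => Fz0.
have M1 : 0 < M ^+ 2 + 1 by rewrite ltr_wpDl ?sqr_ge0.
have [n hn] : exists n, (4 / 7 : R) ^+ n < normc (F z) ^+ 2 / (M ^+ 2 + 1).
  by apply: geometric_small; [lra|rewrite divr_gt0].
have [B BZ nB] := infinite_set_fset n infZ.
have : normc (F z) ^+ 2 <= M ^+ 2 * (4 / 7) ^+ size (take n B).
  apply: (@many_zeros_bound R F z0 r M) => //.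
  - by move=> u ur; apply: FM; rewrite ur.
  - exact/take_uniq/fset_uniq.
  - by move=> a /mem_take /BZ.
rewrite size_take_min (minn_idPl nB).
apply/negP; rewrite -ltNge; move: hn; rewrite ltr_pdivlMr//.
apply: le_lt_trans; rewrite mulrC ler_wpM2l ?exprn_ge0 ?divr_ge0//.
by rewrite lerDl.
Qed.

(** The points near which F vanishes form a subset of U that is open, and
closed in U because zeros are isolated elsewhere. *)
Lemma identity_principle (U : set (R * R)) F z0 : open U -> connected U ->
    (forall z, U z -> sdiff F z) -> U z0 ->
    (forall rho, 0 < rho -> exists z, [/\ z != z0, `|z - z0| <= rho & F z = 0]) ->
  forall z, U z -> F z = 0.
Proof.
move=> oU cU sF Uz0 acc.
have zeros_near z : U z -> exists2 r, 0 < r &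
    (forall w, `|w - z| <= r -> U w /\ F w = 0) \/
    (forall w, w != z -> `|w - z| <= r -> U w /\ F w != 0).
  move=> Uz; have [r r0 rU] : exists2 r, 0 < r & forall w, `|w - z| <= r -> U w.
    exact/nbhs_square/open_nbhs_nbhs.
  have [F0|[rho rho0 F0]] := zeros_isolated r0 (fun w wr => sF w (rU w wr)).
    exists (r / 8); first by rewrite divr_gt0.
    by left=> w wr; split; [apply: rU; lra|exact: F0].
  exists (Num.min r rho); first by rewrite lt_min r0.
  by right=> w wz; rewrite le_min => /andP[wr wrho]; split; [exact: rU|exact: F0].
pose A := interior [set w : R * R | F w = 0].
have oA : open (U `&` A) by apply: openI => //; exact: open_interior.
suff <- : U `&` A = U by move=> z [_] /nbhs_singleton.
apply: cU; last 1 first.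
- exists (closure (U `&` A)); first exact: closed_closure.
  apply/seteqP; split=> z [Uz Az]; split=> //; first exact: subset_closure.
  have [r r0 [F0|F0]] := zeros_near z Uz.
    by apply/nbhs_square; exists r => // w /F0 [].
  have [w [[Uw Aw] wr]] : (U `&` A) `&` [set w | `|w - z| <= r] !=set0.
    by apply: Az; apply/nbhs_square; exists r.
  have [<-//|wz] := eqVneq w z.
  have [_ /eqP[]] := F0 w wz wr; exact: (nbhs_singleton Aw).
- exists z0; split=> //; have [r r0 [F0|F0]] := zeros_near z0 Uz0.
    by apply/nbhs_square; exists r => // w /F0 [].
  by have [z [zz0 zr Fz]] := acc r r0; have [_ /eqP[]] := F0 z zz0 zr.
- by exists (U `&` A) => //; rewrite setIA setIid.
Qed.

End Identity.

(** * Maps with continuous partial derivatives *)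
Section Coordinates.
Variable R : realType.
Implicit Types (p q : quaternion R) (k : 'I_4).

Lemma coordD p q k : (p + q) ord0 k = p ord0 k + q ord0 k.
Proof. exact: mxE. Qed.
Lemma coordN p k : (- p) ord0 k = - p ord0 k.
Proof. exact: mxE. Qed.
Lemma coordB p q k : (p - q) ord0 k = p ord0 k - q ord0 k.
Proof. by rewrite coordD coordN. Qed.
Lemma coordZ (x : R) p k : (x *: p) ord0 k = x * p ord0 k.
Proof. exact: mxE. Qed.

End Coordinates.

Section StrictC1.
Variable R : realType.
Local Notation C := R[i].
Local Notation H := (quaternion R).
Implicit Types (F G : R * R -> C) (a z w : R * R).

Lemma mean_value_between (phi dphi : R -> R) (x y : R) :
    (forall t, Num.min x y <= t <= Num.max x y -> is_derive t 1 phi (dphi t)) ->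
  exists2 c, Num.min x y <= c <= Num.max x y & phi y - phi x = dphi c * (y - x).
Proof.
wlog xy : x y / x <= y => [hwlog|] dp.
  have [xy|] := boolP (x <= y); first exact: (hwlog x y xy dp).
  rewrite -ltNge => /ltW yx.
  have [|c cyx e] := hwlog y x yx; first by rewrite minC maxC.
  by exists c; [rewrite minC maxC|lra].
rewrite (min_l xy) (max_r xy) in dp *.
have [||c] := @MVT_segment R phi dphi x y xy.
- by move=> t; rewrite in_itv/= => /andP[/ltW ? /ltW ?]; apply: dp; apply/andP.
- apply: derivable_within_continuous => t; rewrite in_itv/= => txy.
  by have [] := dp t txy.
by rewrite in_itv/= => cxy e; exists c.
Qed.

Lemma is_derive_fst (u : R * R -> R) (p x y : R) :
  is_derive (x, y) (1, 0) u p -> is_derive x 1 (fun t => u (t, y)) p.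
Proof.
have E : (fun h => h^-1 *: (u (h *: (1, 0) + (x, y)) - u (x, y))) =
         (fun h => h^-1 *: (u (h *: (1 : R) + x, y) - u (x, y))).
  apply/funext => h; congr (_ *: (u _ - _)).
  by congr pair; rewrite /= scaler0 add0r.
case=> du <-; split; first by move: du; rewrite /derivable E.
by rewrite /derive E.
Qed.

Lemma is_derive_snd (u : R * R -> R) (p x y : R) :
  is_derive (x, y) (0, 1) u p -> is_derive y 1 (fun t => u (x, t)) p.
Proof.
have E : (fun h => h^-1 *: (u (h *: (0, 1) + (x, y)) - u (x, y))) =
         (fun h => h^-1 *: (u (x, h *: (1 : R) + y) - u (x, y))).
  apply/funext => h; congr (_ *: (u _ - _)).
  by congr pair; rewrite /= scaler0 add0r.
case=> du <-; split; first by move: du; rewrite /derivable E.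
by rewrite /derive E.
Qed.

(** Apply the mean value theorem along a horizontal and a vertical segment;
strictness comes from the continuity of both partial derivatives at a. *)
Lemma strict_diff_real (u p q : R * R -> R) (U : set (R * R)) a (e : R) :
    open U -> U a ->
    (forall z, U z -> is_derive z (1, 0) u (p z)) ->
    (forall z, U z -> is_derive z (0, 1) u (q z)) ->
    {for a, continuous p} -> {for a, continuous q} -> 0 < e ->
  \forall r \near 0^'+, forall z w, `|z - a| < r -> `|w - a| < r ->
    `|u z - u w - ((z - w).1 * p a + (z - w).2 * q a)|
      <= e * normc (toC (z - w)).
Proof.
move=> oU Ua up uq cp cq e0.
have e20 : 0 < e / 2 by rewrite divr_gt0.
have [r0 r00 Ur0] : exists2 r, 0 < r & forall z, `|z - a| <= r ->
    [/\ U z, `|p a - p z| <= e / 2 & `|q a - q z| <= e / 2].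
  apply/nbhs_square; near=> z; split.
  - by near: z; exact: open_nbhs_nbhs.
  - by near: z; move/cvgrPdist_le : cp; exact.
  - by near: z; move/cvgrPdist_le : cq; exact.
near=> r => -[z1 z2] [w1 w2] zr wr.
have rr0 : r < r0 by near: r; exact: nbhs_right_lt.
move: zr wr; rewrite !prod_normE !gt_max /= => /andP[zr1 zr2] /andP[wr1 wr2].
have between (x y c b : R) : Num.min x y <= c <= Num.max x y ->
    `|x - b| < r -> `|y - b| < r -> `|c - b| <= r0.
  rewrite ge_min le_max !ltr_norml ler_norml => cxy /andP[? ?] /andP[? ?].
  by case/andP: cxy => /orP[] h1 /orP[] h2; apply/andP; split; lra.
have [c cP ec] : exists2 c, Num.min w1 z1 <= c <= Num.max w1 z1 &
    u (z1, z2) - u (w1, z2) = p (c, z2) * (z1 - w1).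
  apply: (@mean_value_between (fun t => u (t, z2)) (fun t => p (t, z2))).
  move=> t tP; apply/is_derive_fst/up.
  have [] // := Ur0 (t, z2); rewrite prod_normE ge_max /=.
  by rewrite (between w1 z1)// (between z2 z2)// ge_min le_max !lexx.
have [d dP ed] : exists2 d, Num.min w2 z2 <= d <= Num.max w2 z2 &
    u (w1, z2) - u (w1, w2) = q (w1, d) * (z2 - w2).
  apply: (@mean_value_between (fun t => u (w1, t)) (fun t => q (w1, t))).
  move=> t tP; apply/is_derive_snd/uq.
  have [] // := Ur0 (w1, t); rewrite prod_normE ge_max /=.
  by apply/andP; split; [apply: (between w1 w1)|exact: (between w2 z2)];
    rewrite // ge_min le_max !lexx.
have -> : u (z1, z2) - u (w1, w2) - ((z1 - w1) * p a + (z2 - w2) * q a) =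
    (p (c, z2) - p a) * (z1 - w1) + (q (w1, d) - q a) * (z2 - w2).
  have -> : u (z1, z2) - u (w1, w2) = (u (z1, z2) - u (w1, z2)) +
    (u (w1, z2) - u (w1, w2)) by ring.
  by rewrite ec ed; ring.
apply: le_trans (ler_normD _ _) _; rewrite !normrM (splitr e) [leRHS]mulrDl.
have [_ hp _] : [/\ U (c, z2), `|p a - p (c, z2)| <= e / 2
    & `|q a - q (c, z2)| <= e / 2].
  apply: Ur0; rewrite prod_normE ge_max /=.
  by rewrite (between w1 z1)// (between z2 z2)// ge_min le_max !lexx.
have [_ _ hq] : [/\ U (w1, d), `|p a - p (w1, d)| <= e / 2
    & `|q a - q (w1, d)| <= e / 2].
  apply: Ur0; rewrite prod_normE ge_max /=.
  by apply/andP; split; [apply: (between w1 w1)|exact: (between w2 z2)];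
    rewrite // ge_min le_max !lexx.
rewrite distrC in hp; rewrite distrC in hq.
by apply: lerD; apply: ler_pM => //;
  [exact: (normc_Re (toC (z1 - w1, z2 - w2)))
  |exact: (normc_Im (toC (z1 - w1, z2 - w2)))].
Unshelve. all: by end_near. Qed.

Lemma strict_diff_quat (g : R * R -> H) (U : set (R * R)) a (e : R) :
    open U -> U a -> C1_on U g -> 0 < e ->
  \forall r \near 0^'+, forall z w, `|z - a| < r -> `|w - a| < r ->
    `|g z - g w - ((z - w).1 *: 'D_(1, 0) g a + (z - w).2 *: 'D_(0, 1) g a)|
      <= e * normc (toC (z - w)).
Proof.
move=> oU Ua gC1 e0.
have coord k : \forall r \near 0^'+, forall z w, `|z - a| < r -> `|w - a| < r ->
    `|g z ord0 k - g w ord0 k - ((z - w).1 * 'D_(1, 0) g a ord0 k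
       + (z - w).2 * 'D_(0, 1) g a ord0 k)| <= e * normc (toC (z - w)).
  have dg v : v = (1, 0) \/ v = (0, 1) -> forall z, U z ->
      is_derive z v (fun z => g z ord0 k) ('D_v g z ord0 k).
    move=> hv z Uz; have [dgz _] := gC1 v hv z Uz.
    split; first exact: (derivable_mxP g z v).1.
    by rewrite (derive_mx dgz) mxE.
  have cg v : v = (1, 0) \/ v = (0, 1) ->
      {for a, continuous (fun z => 'D_v g z ord0 k)}.
    move=> hv; have [_ cga] := gC1 v hv a Ua.
    exact: (continuous_comp cga (@coord_continuous _ _ _ ord0 k _)).
  exact: (strict_diff_real oU Ua (dg _ (or_introl erefl))
    (dg _ (or_intror erefl)) (cg _ (or_introl erefl)) (cg _ (or_intror erefl)) e0).
have nc : \forall r \near 0^'+, forall (k : 'I_4) z w,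
    `|z - a| < r -> `|w - a| < r ->
    `|g z ord0 k - g w ord0 k - ((z - w).1 * 'D_(1, 0) g a ord0 k
       + (z - w).2 * 'D_(0, 1) g a ord0 k)| <= e * normc (toC (z - w)).
  by apply: filter_forall => k; exact: coord.
near=> r => z w zr wr.
have hk k : `|g z ord0 k - g w ord0 k - ((z - w).1 * 'D_(1, 0) g a ord0 k
    + (z - w).2 * 'D_(0, 1) g a ord0 k)| <= e * normc (toC (z - w)).
  exact: (near nc r).
rewrite [leLHS]/Num.Def.normr [leLHS]/= mx_normrE.
apply: bigmax_le => [|[i k] _]; first by rewrite mulr_ge0 ?normc_ge0 ?(ltW e0).
move: (hk k); move: ('D_(1, 0) g a) ('D_(0, 1) g a) => A B.
by rewrite (ord1 i) !coordB coordD !coordZ.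
Unshelve. all: by end_near. Qed.

End StrictC1.

(** * Slice coordinates *)
Section SliceCoordinates.
Variable R : realType.
Local Notation C := R[i].
Local Notation H := (quaternion R).
Local Notation rc := (real_complex R).
Implicit Types (p q I J : H) (k : 'I_4) (a z w : R * R).

Lemma coord_le_norm q k : `|q ord0 k| <= `|q|.
Proof.
rewrite [leRHS]/Num.Def.normr [leRHS]/= mx_normrE.
exact: (le_bigmax _ (fun ij => `|q ij.1 ij.2|) (ord0, k)).
Qed.

Lemma norm_le_coord q (e : R) : 0 <= e -> (forall k, `|q ord0 k| <= e) ->
  `|q| <= e.
Proof.
move=> e0 qe; rewrite [leLHS]/Num.Def.normr [leLHS]/= mx_normrE.
by apply: bigmax_le => // -[i k] _; rewrite (ord1 i).
Qed.

Lemma norm_mul_le p q : `|p * q| <= 4 * (`|p| * `|q|).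
Proof.
have pq (i j : 'I_4) : - (`|p| * `|q|) <= p ord0 i * q ord0 j <= `|p| * `|q|.
  by rewrite -ler_norml normrM ler_pM// coord_le_norm.
apply: norm_le_coord => [|k]; first by rewrite mulr_ge0 ?mulr_ge0.
rewrite -[p * q]/(quat_mul p q) /quat_mul /quat mxE ler_norml.
pose o0 := @Ordinal 4 0 isT; pose o1 := @Ordinal 4 1 isT.
pose o2 := @Ordinal 4 2 isT; pose o3 := @Ordinal 4 3 isT.
case: k => [[|[|[|[|//]]]] lt] /=;
  rewrite /quat0 /quat1 /quat2 /quat3 -/o0 -/o1 -/o2 -/o3.
- have /andP[? ?] := pq o0 o0; have /andP[? ?] := pq o1 o1.
  have /andP[? ?] := pq o2 o2; have /andP[? ?] := pq o3 o3.
  by apply/andP; split; lra.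
- have /andP[? ?] := pq o0 o1; have /andP[? ?] := pq o1 o0.
  have /andP[? ?] := pq o2 o3; have /andP[? ?] := pq o3 o2.
  by apply/andP; split; lra.
- have /andP[? ?] := pq o0 o2; have /andP[? ?] := pq o1 o3.
  have /andP[? ?] := pq o2 o0; have /andP[? ?] := pq o3 o1.
  by apply/andP; split; lra.
- have /andP[? ?] := pq o0 o3; have /andP[? ?] := pq o1 o2.
  have /andP[? ?] := pq o2 o1; have /andP[? ?] := pq o3 o0.
  by apply/andP; split; lra.
Qed.

(** For a fixed imaginary unit J this is the k-th coordinate of q completed to
a map that is complex linear when the quaternions are a complex vector space
under left multiplication by J (see [slice_coord_mul]). It turns the
J-holomorphic restriction of f into ordinary holomorphic functions. *)
Definition slice_coord J k q : C := Complex (q ord0 k) (- (J * q) ord0 k).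

Lemma slice_coordD J k p q :
  slice_coord J k (p + q) = slice_coord J k p + slice_coord J k q.
Proof. by rewrite /slice_coord mulrDr !coordD opprD. Qed.

Lemma slice_coordN J k q : slice_coord J k (- q) = - slice_coord J k q.
Proof. by rewrite /slice_coord mulrN !coordN. Qed.

Lemma slice_coordZ J k (x : R) q :
  slice_coord J k (x *: q) = rc x * slice_coord J k q.
Proof.
rewrite /slice_coord -scalerAr !coordZ.
by apply/eqP; rewrite eq_complex /=; apply/andP; split; apply/eqP; ring.
Qed.

Lemma slice_coord_mul J k q : imag_units J ->
  slice_coord J k (J * q) = Complex 0 1 * slice_coord J k q.
Proof.
move=> J2; rewrite /slice_coord mulrA -expr2 J2 mulN1r coordN.
by apply/eqP; rewrite eq_complex /=; apply/andP; split; apply/eqP; ring.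
Qed.

Lemma slice_coord_le J k q : normc (slice_coord J k q) <= (1 + 4 * `|J|) * `|q|.
Proof.
apply: le_trans (normc_le_ReIm _) _; rewrite mulrDl mul1r normrN.
apply: lerD; first exact: coord_le_norm.
by apply: le_trans (coord_le_norm _ _) _; rewrite -mulrA norm_mul_le.
Qed.

(** The Cauchy-Riemann equation says that the derivative in y is J times the
derivative A in x; by linearity the increment of the slice coordinate is the
slice coordinate of A times the complex increment. *)
Lemma sdiff_slice_coord J k (g : R * R -> H) (U : set (R * R)) a :
    imag_units J -> open U -> U a -> C1_on U g ->
    2^-1 *: ('D_(1, 0) g a + J * 'D_(0, 1) g a) = 0 ->
  sdiff (fun z => slice_coord J k (g z)) a.
Proof.
move=> J2 oU Ua gC1 /eqP; rewrite scaler_eq0 invr_eq0 pnatr_eq0 /= => /eqP CR.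
set A := 'D_(1, 0) g a in CR; set B := 'D_(0, 1) g a in CR.
have BE : B = J * A.
  rewrite -[A]addr0 -(subrr (J * B)) addrA CR add0r mulrN mulrA -expr2 J2.
  by rewrite mulN1r opprK.
exists (slice_coord J k A) => e e0.
have K0 : 0 < 1 + 4 * `|J| by have := normr_ge0 J; lra.
have := strict_diff_quat oU Ua gC1 (divr_gt0 e0 K0).
apply: filterS => r hr z w zr wr; have := hr z w zr wr; rewrite -/A -/B BE.
have -> : slice_coord J k (g z) - slice_coord J k (g w)
    - slice_coord J k A * toC (z - w) =
  slice_coord J k (g z - g w - ((z - w).1 *: A + (z - w).2 *: (J * A))).
  rewrite !(slice_coordD, slice_coordN, slice_coordZ) slice_coord_mul//.
  have -> : toC (z - w) = rc (z - w).1 + rc (z - w).2 * Complex 0 1.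
    by apply/eqP; rewrite eq_complex /=; apply/andP; split; apply/eqP; ring.
  by ring.
move=> h; apply: le_trans (slice_coord_le _ _ _) _.
by rewrite mulrC -ler_pdivlMr// mulrAC.
Qed.

Definition conj_point z : R * R := (z.1, - z.2).

Lemma conj_pointB z w : conj_point (z - w) = conj_point z - conj_point w.
Proof. by congr pair; rewrite /= opprD. Qed.

Lemma norm_conj_point z : `|conj_point z| = `|z|.
Proof. by rewrite !prod_normE /= normrN. Qed.

Lemma normc_conj (x : C) : normc (conjc x) = normc x.
Proof. by case: x => u v /=; rewrite sqrrN. Qed.

Lemma sdiff_conj (F : R * R -> C) a : sdiff F (conj_point a) ->
  sdiff (fun z => conjc (F (conj_point z))) a.
Proof.
move=> [d Fd]; exists (conjc d) => e /Fd; apply: filterS => r hr z w zr wr.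
have := hr (conj_point z) (conj_point w).
rewrite -!conj_pointB !norm_conj_point => /(_ zr wr).
have -> : toC (conj_point (z - w)) = conjc (toC (z - w)) by [].
move: (toC (z - w)) => h; rewrite -(normc_conj (_ - _ - _)) !rmorphB rmorphM.
by rewrite normc_conj -[X in _ * X]/(conjc (conjc h)) conjcK.
Qed.

Lemma sdiff_continuous_Re (F : R * R -> C) a :
  sdiff F a -> {for a, continuous (fun z => Re (F z))}.
Proof.
move=> sF; apply/cvgrPdist_le => e e0.
have [r r0 hr] := near_right0 (sdiff_near sF e0).
near=> z; have zr : `|z - a| < r by rewrite distrC; near: z; exact: cvgr_dist_lt.
apply: le_trans (hr z zr); rewrite distrC -ReN -ReD; exact: normc_Re.
Unshelve. all: by end_near. Qed.

Lemma sdiff_continuous_Im (F : R * R -> C) a :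
  sdiff F a -> {for a, continuous (fun z => Im (F z))}.
Proof.
move=> sF; apply/cvgrPdist_le => e e0.
have [r r0 hr] := near_right0 (sdiff_near sF e0).
near=> z; have zr : `|z - a| < r by rewrite distrC; near: z; exact: cvgr_dist_lt.
apply: le_trans (hr z zr); rewrite distrC -ImN -ImD; exact: normc_Im.
Unshelve. all: by end_near. Qed.

End SliceCoordinates.

(** * Imaginary units and points of the slices *)
Section SlicePoint.
Variable R : realType.
Local Notation H := (quaternion R).
Implicit Types (p q I J : H) (z w : R * R).

Definition unit_i : H := quat 0 1 0 0.

Lemma quat_mulE p q : p * q = quat_mul p q. Proof. by []. Qed.

Lemma quat0N p : quat0 (- p) = - quat0 p. Proof. exact: mxE. Qed.
Lemma quat1N p : quat1 (- p) = - quat1 p. Proof. exact: mxE. Qed.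
Lemma quat2N p : quat2 (- p) = - quat2 p. Proof. exact: mxE. Qed.
Lemma quat3N p : quat3 (- p) = - quat3 p. Proof. exact: mxE. Qed.
Lemma quat_0 : (0 : H) = quat 0 0 0 0.
Proof. by apply: quatP; rewrite !quatE /quat0 /quat1 /quat2 /quat3 mxE. Qed.

Lemma quat_1 : (1 : H) = quat 1 0 0 0. Proof. by []. Qed.

Definition quat_simp :=
  (quat_mulE, quat_1, quat_0, quatE, quat0N, quat1N, quat2N, quat3N).

(** If J^2 = -1 and the real part of J were not 0, then the vector part would
vanish and J would be a real number of square -1. *)
Lemma imag_unitsP J : imag_units J <-> quat0 J = 0 /\
  quat1 J ^+ 2 + quat2 J ^+ 2 + quat3 J ^+ 2 = 1.
Proof.
split=> [JJ|[J0 J1]]; last first.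
  apply: quatP; rewrite ?expr2 /quat_mul !quat_simp ?J0; try ring.
  by rewrite mul0r sub0r -[in RHS]J1; ring.
have E : J * J = - 1 by rewrite -expr2.
have [J0|J0] := eqVneq (quat0 J) 0.
  split=> //; move/(congr1 (@quat0 R)): E.
  by rewrite !quat_simp J0 => e; lra.
have vec0 x : quat0 J * x + x * quat0 J = 0 -> x = 0.
  by move=> e; apply: (mulfI J0); lra.
have J1 : quat1 J = 0.
  move/(congr1 (@quat1 R)): E; rewrite !quat_simp => e.
  by apply: vec0; lra.
have J2 : quat2 J = 0.
  move/(congr1 (@quat2 R)): E; rewrite !quat_simp => e.
  by apply: vec0; lra.
have J3 : quat3 J = 0.
  move/(congr1 (@quat3 R)): E; rewrite !quat_simp => e.
  by apply: vec0; lra.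
move/(congr1 (@quat0 R)): E; rewrite !quat_simp.
rewrite J1 J2 J3 => e; have := sqr_ge0 (quat0 J); rewrite expr2; lra.
Qed.

Lemma imag_unit_i : imag_units unit_i.
Proof. by apply/imag_unitsP; rewrite !quatE; split=> //; ring. Qed.

Lemma imag_unitsN J : imag_units J -> imag_units (- J).
Proof. by rewrite /imag_units/= sqrrN. Qed.

Lemma slice_point_conj J z : slice_point J (conj_point z) = slice_point (- J) z.
Proof. by rewrite /slice_point /= scaleNr scalerN. Qed.

Lemma slice_point_real I J (x : R) : slice_point I (x, 0) = slice_point J (x, 0).
Proof. by rewrite /slice_point /= !scale0r. Qed.

Lemma slice_pointE J z : slice_point J z =
  quat (z.1 + z.2 * quat0 J) (z.2 * quat1 J) (z.2 * quat2 J) (z.2 * quat3 J).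
Proof.
by apply: quatP; rewrite /slice_point !quat_simp; ring.
Qed.

Lemma slice_point_exists q : exists J z, imag_units J /\ q = slice_point J z.
Proof.
pose n := quat1 q ^+ 2 + quat2 q ^+ 2 + quat3 q ^+ 2.
have n_ge0 : 0 <= n by rewrite !addr_ge0 ?sqr_ge0.
have [n0|n0] := eqVneq n 0.
  exists unit_i, (quat0 q, 0); split; first exact: imag_unit_i.
  move/eqP: n0; rewrite /n paddr_eq0 ?addr_ge0 ?sqr_ge0// paddr_eq0 ?sqr_ge0//.
  rewrite !sqrf_eq0 => /andP[/andP[/eqP q1 /eqP q2] /eqP q3].
  by rewrite slice_pointE; apply: quatP; rewrite !quatE /= ?q1 ?q2 ?q3; ring.
pose y := Num.sqrt n; have y0 : y != 0 by rewrite sqrtr_eq0 -ltNge lt_def n0.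
exists (quat 0 (quat1 q / y) (quat2 q / y) (quat3 q / y)), (quat0 q, y).
split.
  apply/imag_unitsP; rewrite !quatE; split=> //.
  by rewrite !expr_div_n -!mulrDl sqr_sqrtr// divff.
by rewrite slice_pointE; apply: quatP; rewrite !quatE /=; field.
Qed.

Lemma slice_point_continuous J : continuous (slice_point J).
Proof.
move=> z; rewrite /slice_point; apply: cvgD; apply: cvgZ; try exact: cvg_cst.
  exact: cvg_fst.
exact: cvg_snd.
Qed.

Lemma imag_unit_le1 J (k : 'I_4) : imag_units J -> `|J ord0 k| <= 1.
Proof.
move=> /imag_unitsP[J0 J1]; rewrite -[leRHS]ger0_norm// -ler_sqr ?nnegrE//.
rewrite !real_normK ?num_real// expr1n -J1.
have := sqr_ge0 (quat1 J); have := sqr_ge0 (quat2 J); have := sqr_ge0 (quat3 J).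
case: k => [[|[|[|[|//]]]] lt]; rewrite (bool_irrelevance lt isT).
- by rewrite -[J ord0 _]/(quat0 J) J0; lra.
- by rewrite -[J ord0 _]/(quat1 J); lra.
- by rewrite -[J ord0 _]/(quat2 J); lra.
- by rewrite -[J ord0 _]/(quat3 J); lra.
Qed.

End SlicePoint.

(** * The stem function and the representation formula *)
Section Stem.
Variable R : realType.
Local Notation C := R[i].
Local Notation H := (quaternion R).
Local Notation rc := (real_complex R).
Local Notation unit_i := (unit_i R).
Variables (Omega : set H) (f : H -> H).
Hypothesis slice_domain_Omega : slice_domain Omega.
Hypothesis symmetric_Omega : axially_symmetric Omega.
Hypothesis regular_f : slice_regular Omega f.
Implicit Types (I J : H) (k : 'I_4) (a z w : R * R).

(** The points x + iy for which x + yI lies in Omega; by axial symmetry the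
choice of the imaginary unit I does not matter ([traceE]). *)
Definition trace : set (R * R) := slice_point unit_i @^-1` Omega.

Lemma trace_indep I J z : imag_units I -> imag_units J ->
  Omega (slice_point I z) -> Omega (slice_point J z).
Proof.
case: z => x y I2 J2 Oz; apply: (symmetric_Omega I2 Oz).
by exists J.
Qed.

Lemma traceE J : imag_units J -> slice_point J @^-1` Omega = trace.
Proof.
move=> J2; apply/seteqP; split=> z; apply: trace_indep => //;
exact: imag_unit_i.
Qed.

Lemma open_trace : open trace.
Proof.
have [[oO _] _ _] := slice_domain_Omega.
by apply: open_comp => // z _; exact: slice_point_continuous.
Qed.

Lemma connected_trace : connected trace.
Proof.
have [_ _ /(_ _ (imag_unit_i R)) [_ cO]] := slice_domain_Omega.
pose pr (q : H) := (quat0 q, quat1 q).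
have prK z : pr (slice_point unit_i z) = z.
  by case: z => x y; rewrite slice_pointE /pr /unit_i !quatE /=; congr pair; ring.
have -> : trace = pr @` (Omega `&` slice unit_i).
  apply/seteqP; split=> [z Oz|_ [q [Oq [z _ zq]] <-]].
    by exists (slice_point unit_i z) => //; split=> //; exists z.
  by rewrite -zq prK /trace /= zq.
apply: connected_continuous_connected => //.
apply: continuous_subspaceT => q;
  exact: (cvg_pair (@coord_continuous R 1 4 _ _ q) (@coord_continuous R 1 4 _ _ q)).
Qed.

Lemma trace_conj z : trace z -> trace (conj_point z).
Proof.
rewrite /trace /= slice_point_conj; apply: trace_indep; first exact: imag_unit_i.
exact/imag_unitsN/imag_unit_i.
Qed.

Lemma sdiff_regular J k a : imag_units J -> trace a ->
  sdiff (fun z => slice_coord J k (f (slice_point J z))) a.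
Proof.
move=> J2 Ua; have [C1f CR] := regular_f J2.
rewrite traceE// in C1f CR.
exact: (sdiff_slice_coord k J2 open_trace Ua C1f (CR a Ua)).
Qed.

Definition stem_re z : H :=
  2^-1 *: (f (slice_point unit_i z) + f (slice_point unit_i (conj_point z))).

Definition stem_im z : H := - (2^-1 *:
  (unit_i * (f (slice_point unit_i z) - f (slice_point unit_i (conj_point z))))).

(** Collecting the coordinates of stem_re + i stem_im, these four functions are
the holomorphic stem with f(x + yJ) = stem_re(x, y) + J stem_im(x, y). The
formulas for stem_re and stem_im are forced by that equation for
J = unit_i and J = - unit_i. *)
Definition stem k z : C := Complex (stem_re z ord0 k) (stem_im z ord0 k).

Lemma stemE k z : stem k z =
  rc 2^-1 * (slice_coord unit_i k (f (slice_point unit_i z)) +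
    conjc (slice_coord unit_i k (f (slice_point unit_i (conj_point z))))).
Proof.
rewrite /stem /stem_re /stem_im /slice_coord coordZ coordD.
rewrite coordN coordZ mulrBr coordB.
by apply/eqP; rewrite eq_complex /=; apply/andP; split; apply/eqP; ring.
Qed.

Lemma sdiff_stem k a : trace a -> sdiff (stem k) a.
Proof.
move=> Ua; have -> : stem k = (fun z => rc 2^-1 *
    (slice_coord unit_i k (f (slice_point unit_i z)) +
     conjc (slice_coord unit_i k (f (slice_point unit_i (conj_point z)))))).
  by apply/funext => z; exact: stemE.
apply: sdiffM; first exact: sdiff_cst.
apply: sdiffD; first exact: (sdiff_regular k (imag_unit_i R) Ua).
apply: (@sdiff_conj _ (fun z => slice_coord unit_i k (f (slice_point unit_i z)))).
exact: (sdiff_regular k (imag_unit_i R) (trace_conj Ua)).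
Qed.

Lemma stem_im_real (x : R) : stem_im (x, 0) = 0.
Proof. by rewrite /stem_im /conj_point /= oppr0 subrr mulr0 scaler0 oppr0. Qed.

Lemma stem_re_real (x : R) : stem_re (x, 0) = f (slice_point unit_i (x, 0)).
Proof.
rewrite /stem_re /conj_point /= oppr0 scalerDr -scalerDl.
by rewrite (_ : 2^-1 + 2^-1 = 1) ?scale1r//; lra.
Qed.

Lemma coord_mul J p k :
  (J * p) ord0 k = \sum_(l < 4) p ord0 l * (J * 'e_l : H) ord0 k.
Proof.
rewrite {1}(row_sum_delta p : p = \sum_(l < 4) p ord0 l *: ('e_l : H)).
rewrite mulr_sumr summxE; apply: eq_bigr => l _.
by rewrite -scalerAr coordZ.
Qed.

(** The right-hand side is a combination of the stem coordinates with constant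
coefficients, which shows that stem_re + J stem_im is J-holomorphic. *)
Lemma slice_coord_stem J k z : imag_units J ->
  slice_coord J k (stem_re z + J * stem_im z) =
  stem k z + - (Complex 0 1) * \sum_(l < 4) rc ((J * 'e_l : H) ord0 k) * stem l z.
Proof.
move=> J2; rewrite slice_coordD slice_coord_mul//.
have -> : \sum_(l < 4) rc ((J * 'e_l : H) ord0 k) * stem l z =
    Complex ((J * stem_re z) ord0 k) ((J * stem_im z) ord0 k).
  rewrite !coord_mul; elim/big_rec3: _ => [//|l u v w _ ->].
  by apply/eqP; rewrite eq_complex /=; apply/andP; split; apply/eqP; ring.
rewrite /slice_coord /stem.
by apply/eqP; rewrite eq_complex /=; apply/andP; split; apply/eqP; ring.
Qed.

(** The domain meets the real axis and is open, so that the zeros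
accumulate. *)
Lemma trace_identity (F : R * R -> C) : (forall z, trace z -> sdiff F z) ->
  (forall x, trace (x, 0) -> F (x, 0) = 0) -> forall z, trace z -> F z = 0.
Proof.
move=> sF F0; have [_ [x Ox] _] := slice_domain_Omega.
have Ux : trace (x, 0) by rewrite /trace /= /slice_point /= scale0r addr0.
apply: (identity_principle open_trace connected_trace sF Ux) => rho rho0.
have [r r0 rU] : exists2 r, 0 < r & forall w, `|w - (x, 0)| <= r -> trace w.
  by apply/nbhs_square; apply: open_nbhs_nbhs; split => //; exact: open_trace.
pose t := Num.min rho r; have t0 : 0 < t by rewrite lt_min rho0.
have dist : `|(x + t, 0) - (x, 0) : R * R| = t.
  by rewrite prod_normE /= addrAC subrr add0r subrr normr0 gtr0_norm// max_l// ltW.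
exists (x + t, 0); split.
- by rewrite xpair_eqE -subr_eq0 addrAC subrr add0r gt_eqF.
- by rewrite dist ge_min lexx.
- by apply/F0/rU; rewrite dist ge_min lexx orbT.
Qed.

(** Both sides are J-holomorphic on the slice of J and agree on the real axis,
where stem_im vanishes. *)
Lemma representation J z : imag_units J -> trace z ->
  f (slice_point J z) = stem_re z + J * stem_im z.
Proof.
move=> J2 Uz; apply/eqP; rewrite -subr_eq0; apply/eqP.
pose g w := f (slice_point J w) - (stem_re w + J * stem_im w).
rewrite -/(g z).
have g0 k : slice_coord J k (g z) = 0.
  apply: (@trace_identity (fun w => slice_coord J k (g w))) => //.
    move=> w Uw; rewrite (_ : (fun w => _) = fun w =>
        slice_coord J k (f (slice_point J w)) + (- 1) *
        (stem k w + - (Complex 0 1) *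
          \sum_(l < 4) rc ((J * 'e_l : H) ord0 k) * stem l w)); last first.
      apply/funext => u; rewrite /g slice_coordD slice_coordN slice_coord_stem//.
      by rewrite mulN1r.
    apply: sdiffD; first exact: sdiff_regular.
    apply: sdiffM; first exact: sdiff_cst.
    apply: sdiffD; first exact: sdiff_stem.
    apply: sdiffM; first exact: sdiff_cst.
    apply: sdiff_sum => l; apply: sdiffM; first exact: sdiff_cst.
    exact: sdiff_stem.
  move=> y _.
  rewrite /g stem_re_real stem_im_real mulr0 addr0 (slice_point_real unit_i J).
  by rewrite subrr /slice_coord mulr0 mxE oppr0.
by apply/rowP => k; rewrite [RHS]mxE; exact: (congr1 (@complex.Re R) (g0 k)).
Qed.

End Stem.

(** * Hurwitz' theorem *)

(** Zeros of holomorphic functions persist under perturbation: on the boundary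
of the square |F p| stays above a positive m by compactness, while |F p z0| drops
below m, so the minimum principle applies. *)
Lemma hurwitz (R : realType) (T : topologicalType) (F : T -> R * R -> R[i])
    (p0 : T) (z0 : R * R) (r : R) : 0 < r ->
    (forall p z, `|z - z0| <= r -> sdiff (F p) z) ->
    (forall z, `|z - z0| <= r ->
      {for (z, p0), continuous (fun x : (R * R) * T => normc (F x.2 x.1))}) ->
    F p0 z0 = 0 -> (forall z, z != z0 -> `|z - z0| <= r -> F p0 z != 0) ->
  \forall p \near p0, exists2 z, `|z - z0| <= r & F p z = 0.
Proof.
move=> r0 sF cF F00 F0.
pose P (i : T * R) z := `|z - z0| = r -> i.2 <= normc (F i.1 z).
have bdry : \forall i \near filter_prod (nbhs p0) (0^'+),
    [set z | `|z - z0| <= r] `<=` P i.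
  apply: (compact_near_coveringP _).1 (@compact_square R z0 r) _ _ _ _ _ => z zr.
  have [zr'|zr'] := eqVneq `|z - z0| r; last first.
    have zlt : `|z - z0| < r by rewrite lt_neqAle zr'.
    near=> z' i => z'r; exfalso.
    have : `|z' - z0| < r.
      rewrite -(subrKA z); apply: le_lt_trans (ler_normD _ _) _.
      rewrite -ltrBrDr distrC; near: z'; apply: cvgr_dist_lt => //.
      by rewrite subr_gt0.
    by rewrite z'r ltxx.
  have Fz : 0 < normc (F p0 z).
    rewrite normc_gt0; apply: F0 => //; apply: contra_eqN zr' => /eqP ->.
    by rewrite subrr normr0 lt_eqF.
  have [[A B] /= [Az Bp] AB] : nbhs (z, p0)
      [set x : (R * R) * T | normc (F p0 z) / 2 < normc (F x.2 x.1)].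
    by apply: (cvgr_gt _ (cF z zr)); rewrite /= ltr_pdivrMr// ltr_pMr// ltr1n.
  exists (A, B `*` [set m | m < normc (F p0 z) / 2]); first split=> //.
    exists (B, [set m | m < normc (F p0 z) / 2]) => //; split=> //.
    by apply: nbhs_right_lt; rewrite divr_gt0.
  move=> [z' [p m]] /= [Az' [Bp' mlt]] _ /=.
  by apply/ltW/(lt_trans mlt); exact: (AB (z', p)).
have [[B M] /= [Bp M0] BM] := bdry.
have [m m0 Mm] : exists2 m, 0 < m & M m by exact: near_right0.
have small : \forall p \near p0, normc (F p z0) < m.
  have [[A B'] /= [Az Bp'] AB] : nbhs (z0, p0)
      [set x : (R * R) * T | normc (F x.2 x.1) < m].
    by apply: (cvgr_lt _ (cF z0 _)); rewrite /= ?subrr ?normr0 ?F00 ?normc0// ltW.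
  apply: filterS Bp' => p pB; apply: (AB (z0, p)).
  by split=> //; exact: nbhs_singleton.
near=> p; apply: (@min_modulus_zero _ _ _ r m) => //.
- by move=> z; exact: sF.
- move=> z zr; have Pp : (B `*` M) (p, m) by split => //; near: p.
  by apply: (BM _ Pp z) => //; rewrite /= zr.
- by near: p.
Unshelve. all: by end_near. Qed.

(** * Continuity and division of quaternions *)
Section QuaternionContinuity.
Variable R : realType.
Local Notation H := (quaternion R).
Implicit Types (p q c d I J : H) (k : 'I_4).

Section Cvg.
Context {T : Type} {F : set_system T} {FF : Filter F}.
Implicit Types g h : T -> H.

Lemma cvg_quat g q : (forall k, g x ord0 k @[x --> F] --> q ord0 k) -> g @ F --> q.
Proof.
move=> gq; apply/cvgrPdist_le => e e0.
have nc : \forall x \near F, forall k : 'I_4, `|q ord0 k - g x ord0 k| <= e.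
  by apply: filter_forall => k; move/cvgrPdist_le: (gq k); exact.
near=> x; apply: norm_le_coord => [|k]; first exact: ltW.
by rewrite coordB; exact: (near nc x).
Unshelve. all: by end_near. Qed.

Lemma cvg_coord g q k : g @ F --> q -> g x ord0 k @[x --> F] --> q ord0 k.
Proof. by move=> gq; apply: cvg_comp gq (@coord_continuous R 1 4 ord0 k q). Qed.

Lemma cvg_quat_mul g h p q : g @ F --> p -> h @ F --> q ->
  (fun x => g x * h x) @ F --> p * q.
Proof.
move=> gp hq; apply: cvg_quat => k.
have P (i j : 'I_4) : g x ord0 i * h x ord0 j @[x --> F] --> p ord0 i * q ord0 j.
  by apply: cvgM; exact: cvg_coord.
rewrite quat_mulE /quat_mul /quat mxE; under eq_fun => x do
  rewrite quat_mulE /quat_mul /quat mxE.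
by case: k => [[|[|[|[|//]]]] lt] /=; rewrite /quat0 /quat1 /quat2 /quat3;
  repeat first [exact: P | apply: cvgB | apply: cvgD].
Qed.

End Cvg.

Definition quat_conj q : H := quat (quat0 q) (- quat1 q) (- quat2 q) (- quat3 q).
Definition quat_dot p q : R := \sum_(k < 4) p ord0 k * q ord0 k.

Lemma quat_dotE p q : quat_dot p q = quat0 p * quat0 q + quat1 p * quat1 q
  + quat2 p * quat2 q + quat3 p * quat3 q.
Proof.
rewrite /quat_dot !big_ord_recl big_ord0 addr0 !addrA.
rewrite /quat0 /quat1 /quat2 /quat3.
by congr (_ * _ + _ * _ + _ * _ + _ * _); congr (_ _ _); apply: val_inj.
Qed.

Lemma quat_dot_eq0 p : quat_dot p p = 0 -> p = 0.
Proof.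
move=> /eqP; rewrite psumr_eq0 => [/allP h|k _]; last by rewrite -expr2 sqr_ge0.
apply/rowP => k; rewrite mxE; have := h k (mem_index_enum k).
by rewrite /= -expr2 sqrf_eq0 => /eqP.
Qed.

Lemma cvg_quat_dot {T : Type} {F : set_system T} {FF : Filter F}
    (g h : T -> H) p q :
  g @ F --> p -> h @ F --> q -> quat_dot (g x) (h x) @[x --> F] --> quat_dot p q.
Proof.
move=> gp hq; rewrite quat_dotE; under eq_fun => x do rewrite quat_dotE.
by repeat apply: cvgD; apply: cvgM; exact: cvg_coord.
Qed.

Lemma cvg_quat_conj {T : Type} {F : set_system T} {FF : Filter F} (g : T -> H) p :
  g @ F --> p -> quat_conj (g x) @[x --> F] --> quat_conj p.
Proof.
move=> gp; apply: cvg_quat => k; rewrite /quat_conj /quat mxE.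
under eq_fun => x do rewrite mxE.
by case: k => [[|[|[|[|//]]]] lt] /=; try apply: cvgN; exact: cvg_coord.
Qed.

(** The quotient d c^-1. *)
Definition quat_div d c : H := (quat_dot c c)^-1 *: (d * quat_conj c).

Lemma quat_divK d c : c != 0 -> quat_div d c * c = d.
Proof.
move=> c0; have N0 : quat_dot c c != 0 by apply: contra_neq c0; exact: quat_dot_eq0.
rewrite /quat_div -scalerAl -mulrA.
have -> : quat_conj c * c = (quat_dot c c)%:A.
  by apply: quatP; rewrite quat_dotE /quat_conj !quat_simp; ring.
by rewrite -scalerAr mulr1 scalerA mulVf// scale1r.
Qed.

Lemma quat_mulK p c : c != 0 -> quat_div (p * c) c = p.
Proof.
move=> c0; have N0 : quat_dot c c != 0 by apply: contra_neq c0; exact: quat_dot_eq0.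
rewrite /quat_div -mulrA.
have -> : c * quat_conj c = (quat_dot c c)%:A.
  by apply: quatP; rewrite quat_dotE /quat_conj !quat_simp; ring.
by rewrite -scalerAr mulr1 scalerA mulVf// scale1r.
Qed.

(** An imaginary unit is a quaternion of norm 1 orthogonal to 1; the quotient
d c^-1 has norm |d| / |c| and scalar part <d, c> / |c|^2. *)
Lemma quat_div_imag d c : c != 0 -> quat_dot d d = quat_dot c c ->
  quat_dot d c = 0 -> imag_units (quat_div d c).
Proof.
move=> c0; have N0 : quat_dot c c != 0 by apply: contra_neq c0; exact: quat_dot_eq0.
move=> dd dc; apply/imag_unitsP.
rewrite /quat_div quat_mulE /quat_mul /quat_conj !quatE.
set N := quat_dot c c in N0 dd *.
split.
  apply: (mulfI N0); rewrite mulrA mulfV// mul1r mulr0 -[RHS]dc quat_dotE; ring.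
rewrite !exprMn -!mulrDr exprVn; apply: (mulfI (expf_neq0 2 N0)).
rewrite mulrA mulfV ?expf_neq0// mul1r mulr1.
have <- : quat_dot d d * N - quat_dot d c ^+ 2 = N ^+ 2.
  by rewrite dd dc; ring.
by rewrite /N !quat_dotE; ring.
Qed.

Lemma imag_mul_dot I c : imag_units I -> quat_dot (I * c) (I * c) = quat_dot c c.
Proof.
move=> /imag_unitsP[I0 I1]; rewrite -[RHS]mul1r -I1 !quat_dotE.
by rewrite quat_mulE /quat_mul !quatE I0; ring.
Qed.

Lemma imag_mul_dot0 I c : imag_units I -> quat_dot (I * c) c = 0.
Proof.
move=> /imag_unitsP[I0 _]; rewrite !quat_dotE.
by rewrite quat_mulE /quat_mul !quatE I0; ring.
Qed.

End QuaternionContinuity.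

(** * The open mapping theorem *)
Lemma sum_Complex (R : realType) (I : Type) (s : seq I) (u v : I -> R) :
  \sum_(i <- s) Complex (u i) (v i) =
  Complex (\sum_(i <- s) u i) (\sum_(i <- s) v i) :> R[i].
Proof.
by elim/big_rec3: _ => [//|i a b x _ ->].
Qed.

Lemma cvg_comp_fst (T U V : topologicalType) (g : T -> V) (t : T) (u : U) :
  {for t, continuous g} -> g x.1 @[x --> (t, u)] --> g t.
Proof.
move=> cg; have ct : x.1 @[x --> (t, u)] --> t by exact: cvg_fst.
exact: (cvg_comp _ _ ct cg).
Qed.

Lemma cvg_normc (R : realType) {T : Type} {F : set_system T} {FF : Filter F}
    (u v : T -> R) (a b : R) : u @ F --> a -> v @ F --> b ->
  normc (Complex (u x) (v x)) @[x --> F] --> normc (Complex a b).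
Proof.
move=> ua vb; have h : u x ^+ 2 + v x ^+ 2 @[x --> F] --> a ^+ 2 + b ^+ 2.
  by apply: cvgD; exact: cvgM.
exact: (cvg_comp _ _ h (@sqrt_continuous R _)).
Qed.

Section OpenMapping.
Variable R : realType.
Local Notation C := R[i].
Local Notation H := (quaternion R).
Local Notation rc := (real_complex R).
Local Notation unit_i := (unit_i R).
Variables (Omega : set H) (f : H -> H).
Hypothesis slice_domain_Omega : slice_domain Omega.
Hypothesis symmetric_Omega : axially_symmetric Omega.
Hypothesis regular_f : slice_regular Omega f.
Implicit Types (p q I J : H) (k : 'I_4) (a z w : R * R).
Local Notation trace := (trace Omega).
Local Notation stem := (stem f).
Local Notation stem_re := (stem_re f).
Local Notation stem_im := (stem_im f).
Let repr := representation slice_domain_Omega symmetric_Omega regular_f.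
Let sdiff_stem := sdiff_stem slice_domain_Omega symmetric_Omega regular_f.
Let open_trace := open_trace slice_domain_Omega.
Let identity := trace_identity slice_domain_Omega.

(** The symmetrization of f - p restricted to a complex line. By
[norm_stemE] its vanishing at z says that p - stem_re z and stem_im z have the
same length and are orthogonal, which is what is needed to solve
J stem_im z = p - stem_re z by an imaginary unit J. *)
Definition norm_stem p z : C := \sum_(k < 4) (stem k z + - rc (p ord0 k)) ^+ 2.

Lemma norm_stemE p z : norm_stem p z = Complex
  (quat_dot (stem_re z - p) (stem_re z - p) - quat_dot (stem_im z) (stem_im z))
  (2 * quat_dot (stem_re z - p) (stem_im z)).
Proof.
rewrite /quat_dot mulr_sumr -sumrB -sum_Complex; apply: eq_bigr => k _.
rewrite coordB; apply/eqP; rewrite eq_complex /stem /=.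
by apply/andP; split; apply/eqP; ring.
Qed.

Lemma sdiff_norm_stem p z : trace z -> sdiff (norm_stem p) z.
Proof.
move=> Uz; apply: sdiff_sum => k; apply: sdiffX; apply: sdiffD.
  exact: sdiff_stem.
exact: sdiff_cst.
Qed.

Lemma stem_re_continuous z : trace z -> {for z, continuous stem_re}.
Proof.
by move=> Uz; apply: cvg_quat => k; exact: sdiff_continuous_Re (sdiff_stem k Uz).
Qed.

Lemma stem_im_continuous z : trace z -> {for z, continuous stem_im}.
Proof.
by move=> Uz; apply: cvg_quat => k; exact: sdiff_continuous_Im (sdiff_stem k Uz).
Qed.

Lemma norm_stem_continuous z p : trace z ->
  {for (z, p), continuous (fun x : (R * R) * H => normc (norm_stem x.2 x.1))}.
Proof.
move=> Uz.
have cre : (stem_re x.1 - x.2) @[x --> (z, p)] --> stem_re z - p.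
  apply: cvgB; last exact: cvg_snd.
  exact: cvg_comp_fst (stem_re_continuous Uz).
have cim : stem_im x.1 @[x --> (z, p)] --> stem_im z.
  exact: cvg_comp_fst (stem_im_continuous Uz).
have h1 : quat_dot (stem_re x.1 - x.2) (stem_re x.1 - x.2) -
      quat_dot (stem_im x.1) (stem_im x.1) @[x --> (z, p)] -->
    quat_dot (stem_re z - p) (stem_re z - p) - quat_dot (stem_im z) (stem_im z).
  by apply: cvgB; exact: cvg_quat_dot.
have h2 : 2 * quat_dot (stem_re x.1 - x.2) (stem_im x.1) @[x --> (z, p)] -->
    2 * quat_dot (stem_re z - p) (stem_im z).
  by apply: cvgM; [exact: cvg_cst|exact: cvg_quat_dot].
rewrite /prop_for /continuous_at; under eq_fun => x do rewrite norm_stemE.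
by rewrite norm_stemE; exact: cvg_normc.
Qed.

Lemma norm_stem_value I z : imag_units I -> trace z ->
  norm_stem (f (slice_point I z)) z = 0.
Proof.
move=> I2 Uz; rewrite norm_stemE (repr I2 Uz) opprD addNKr.
have -> : - (I * stem_im z) = (- I) * stem_im z by rewrite mulNr.
rewrite imag_mul_dot ?imag_mul_dot0 ?subrr ?mulr0//; exact: imag_unitsN.
Qed.

(** Where stem_im vanishes, the equation forces stem_re z = p and any J
solves it. *)
Lemma norm_stem_zero p z : trace z -> norm_stem p z = 0 ->
  exists J, [/\ imag_units J, f (slice_point J z) = p &
    stem_im z != 0 -> J = quat_div (p - stem_re z) (stem_im z)].
Proof.
move=> Uz; rewrite norm_stemE => -[/eqP]; rewrite subr_eq0 => /eqP h1 h2.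
have [c0|c0] := eqVneq (stem_im z) 0.
  exists unit_i; split; [exact: imag_unit_i| |by []].
  rewrite repr ?c0 ?mulr0 ?addr0//; last exact: imag_unit_i.
  apply/eqP; rewrite -subr_eq0; apply/eqP/quat_dot_eq0.
  by rewrite h1 c0 /quat_dot big1// => k _; rewrite mxE mul0r.
have J2 : imag_units (quat_div (p - stem_re z) (stem_im z)).
  apply: quat_div_imag => //.
    rewrite -h1 !quat_dotE -(opprB p) !quat_simp; ring.
  apply: (mulfI (_ : -2 != 0 :> R)); first by rewrite oppr_eq0 pnatr_eq0.
  rewrite mulr0 -[RHS]h2 !quat_dotE -(opprB p) !quat_simp; ring.
exists (quat_div (p - stem_re z) (stem_im z)); split=> //.
by rewrite repr// quat_divK// addrC subrK.
Qed.

Lemma degenerate_stem_im0 I z : imag_units I -> trace z -> z.2 != 0 ->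
  stem_im z = 0 -> degenerate_set Omega f (slice_point I z).
Proof.
case: z => x y I2 Uz /= y0 c0; exists x, y; split=> //.
- by move=> _ [J J2 <-]; exact: (trace_indep symmetric_Omega (imag_unit_i R) J2 Uz).
- by move=> _ _ [J J2 <-] [J' J'2 <-]; rewrite !repr// c0 !mulr0.
- by exists I.
Qed.

(** If norm_stem p vanished near z0 it would vanish on the whole trace. At real
points stem_im is 0, so that stem_re = p there, and the stem is the constant p
everywhere. Then all spheres are degenerate, and every point of Omega is a limit
of points on such spheres. *)
Lemma not_locally_zero I z0 p (r : R) : imag_units I -> trace z0 ->
    ~ closure (degenerate_set Omega f) (slice_point I z0) -> 0 < r ->
  ~ (forall z, `|z - z0| <= r -> norm_stem p z = 0).
Proof.
move=> I2 Uz0 ncl r0 F0.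
have {}F0 z : trace z -> norm_stem p z = 0.
  apply: (identity_principle open_trace _ (@sdiff_norm_stem p) Uz0).
    exact: connected_trace.
  move=> rho rho0; pose t := Num.min rho r.
  have t0 : 0 < t by rewrite lt_min rho0.
  have dist : `|(z0.1 + t, z0.2) - z0 : R * R| = t.
    rewrite prod_normE /= addrAC subrr add0r subrr normr0 gtr0_norm//.
    by rewrite max_l// ltW.
  exists (z0.1 + t, z0.2); split.
  - rewrite -subr_eq0; apply/eqP => e; move: dist; rewrite e normr0 => t0'.
    by rewrite -t0' ltxx in t0.
  - by rewrite dist ge_min lexx.
  - by apply: F0; rewrite dist ge_min lexx orbT.
have stem_cst k z : trace z -> stem k z + - rc (p ord0 k) = 0.
  apply: (@identity (fun z => stem k z + - rc (p ord0 k))) => [w Uw|x Ux].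
    by apply: sdiffD; [exact: sdiff_stem|exact: sdiff_cst].
  have := F0 _ Ux; rewrite norm_stemE stem_im_real => -[].
  have -> : quat_dot (0 : H) 0 = 0 by rewrite quat_dotE !quat_simp; ring.
  rewrite subr0 => /quat_dot_eq0 e _.
  have {}e : stem_re (x, 0) = p by apply/eqP; rewrite -subr_eq0 e.
  rewrite /stem e stem_im_real mxE.
  by apply/eqP; rewrite eq_complex /= subrr oppr0 addr0 eqxx.
have im0 z : trace z -> stem_im z = 0.
  move=> Uz; apply/rowP => k; rewrite [RHS]mxE.
  have := congr1 (@complex.Im R) (stem_cst k z Uz).
  by rewrite ImD ImN [Im (rc _)]/= oppr0 addr0.
apply: ncl => B /(slice_point_continuous) /nbhs_square[s s0 sB].
have [t t0 tU] : exists2 t, 0 < t & forall z, `|z - z0| <= t -> trace z.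
  by apply/nbhs_square; apply: open_nbhs_nbhs.
(* A nearby point off the real axis: only non-real points lie on the spheres
   that make up the degenerate set. *)
pose y := if z0.2 == 0 then Num.min s t else z0.2.
have st0 : 0 < Num.min s t by rewrite lt_min s0.
have dist : `|(z0.1, y) - z0 : R * R| <= Num.min s t.
  rewrite prod_normE /= subrr normr0 ge_max (ltW st0) /y /=.
  case: eqVneq => [->|_]; first by rewrite subr0 gtr0_norm.
  by rewrite subrr normr0 ltW.
move: (dist); rewrite le_min => /andP[ds dt].
exists (slice_point I (z0.1, y)); split; last exact: sB.
apply: degenerate_stem_im0 => //; [exact: tU| |by apply: im0; exact: tU].
by rewrite /y /=; case: ifPn => // _; rewrite gt_eqF.
Qed.

(** Around a real point the whole sphere through x + yJ is close, so that J
may be arbitrary. *)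
Lemma dist_real_sphere I J (x : R) z : imag_units J ->
  `|slice_point J z - slice_point I (x, 0)| <= `|z - (x, 0)|.
Proof.
move=> J2; rewrite (slice_point_real I J) !slice_pointE.
have J0 : quat0 J = 0 by have /imag_unitsP[] := J2.
have J1 k : `|z.2 * J ord0 k| <= `|z - (x, 0)|.
  rewrite normrM -[leRHS]mulr1 ler_pM ?imag_unit_le1//.
  by have := normr2_le (z - (x, 0)); rewrite /= subr0.
apply: norm_le_coord => // k; rewrite coordB /quat !mxE.
case: k => [[|[|[|[|//]]]] lt] /=; rewrite ?mul0r ?subr0; try exact: J1.
by rewrite J0 mulr0 !addr0; exact: (normr1_le (z - (x, 0))).
Qed.

(** Points q = slice_point J z with f q = p correspond to zeros z of
norm_stem p, which persist for p near f q0 by [hurwitz]. It remains to see that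
q stays in V. For q0 real this holds for all J. Otherwise stem_im z0 is not 0,
as the sphere of q0 is not degenerate, and J = (p - stem_re z) (stem_im z)^-1
depends continuously on z and p. *)
Lemma nbhs_image (V : set H) q0 : open V ->
    V `<=` Omega `\` closure (degenerate_set Omega f) -> V q0 ->
  nbhs (f q0) (f @` V).
Proof.
move=> oV VO; have [I [z0 [I2 ->]]] := slice_point_exists q0 => Vq0.
have [Oq0 ncl] := VO _ Vq0.
have Uz0 : trace z0 by exact: (trace_indep symmetric_Omega I2 (imag_unit_i R) Oq0).
set p0 := f _.
have [r1 r10 r1U] : exists2 r, 0 < r & forall z, `|z - z0| <= r -> trace z.
  by apply/nbhs_square; apply: open_nbhs_nbhs.
have [F0|[r2 r20 F0]] :=
  zeros_isolated r10 (fun z zr => @sdiff_norm_stem p0 z (r1U z zr)).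
  by case: (not_locally_zero I2 Uz0 ncl (divr_gt0 r10 (ltr0n _ 8)) F0).
have nV : nbhs (slice_point I z0) V by apply: open_nbhs_nbhs.
have [r3 r30 r3V] : exists2 r, 0 < r & \forall p \near p0, forall z J,
    `|z - z0| <= r -> trace z -> imag_units J -> f (slice_point J z) = p ->
    (stem_im z != 0 -> J = quat_div (p - stem_re z) (stem_im z)) ->
    V (slice_point J z).
  have [y0|y0] := eqVneq z0.2 0.
    have /nbhs_normP[r /= r0 rV] := nV.
    exists (r / 2); first by rewrite divr_gt0.
    near=> p => z J zr _ J2 _ _; apply: rV; rewrite /ball_/= distrC.
    move: zr; rewrite (_ : z0 = (z0.1, 0)) => [zr|]; last first.
      by rewrite -y0; case: (z0).
    by apply: le_lt_trans (dist_real_sphere _ _ _ J2) _; lra.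
  have c0 : stem_im z0 != 0.
    apply/eqP => c0; apply: ncl; apply: subset_closure.
    exact: degenerate_stem_im0.
  pose J_ (x : (R * R) * H) := quat_div (x.2 - stem_re x.1) (stem_im x.1).
  have JE : J_ (z0, p0) = I.
    by rewrite /J_ /= /p0 (repr I2 Uz0) addrC addKr quat_mulK.
  have cim : stem_im x.1 @[x --> (z0, p0)] --> stem_im z0.
    exact: cvg_comp_fst (stem_im_continuous Uz0).
  have cJ : J_ x @[x --> (z0, p0)] --> I.
    rewrite -JE; apply: cvgZ.
      apply: cvgV; last exact: cvg_quat_dot.
      by apply: contra_neq c0; exact: quat_dot_eq0.
    apply: cvg_quat_mul; last exact: cvg_quat_conj.
    apply: cvgB; first exact: cvg_snd.
    exact: cvg_comp_fst (stem_re_continuous Uz0).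
  have cpt : slice_point (J_ x) x.1 @[x --> (z0, p0)] --> slice_point I z0.
    apply: cvgD; apply: cvgZ; try exact: cvg_cst; last exact: cJ.
      by apply: (@cvg_comp_fst _ _ _ fst); case: (z0) => x y; exact: cvg_fst.
    by apply: (@cvg_comp_fst _ _ _ snd); case: (z0) => x y; exact: cvg_snd.
  have [[A B] /= [Az Bp] AB] : nbhs (z0, p0) [set x : (R * R) * H |
      stem_im x.1 != 0 /\ V (slice_point (J_ x) x.1)].
    by near=> x; split; near: x; [exact: cvgr_neq0 cim c0|exact: cpt nV].
  have [r r0 rA] := (nbhs_square _ _).1 Az.
  exists r => //; near=> p => z J zr _ _ _ JP.
  have Bpp : B p by near: p.
  have [c0' Vx] := AB (z, p) (conj (rA z zr) Bpp).
  by rewrite (JP c0').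
pose r := Num.min r1 (Num.min r2 r3).
have r0 : 0 < r by rewrite !lt_min r10 r20.
have rU z : `|z - z0| <= r -> trace z by rewrite le_min => /andP[/r1U].
have rr3 z : `|z - z0| <= r -> `|z - z0| <= r3 by rewrite !le_min => /and3P[].
have zero_near : \forall p \near p0, exists2 z, `|z - z0| <= r & norm_stem p z = 0.
  apply: (@hurwitz R H norm_stem p0 z0 r r0) => [p z zr|z zr||z zz0].
  - exact/sdiff_norm_stem/rU.
  - exact/norm_stem_continuous/rU.
  - exact: norm_stem_value.
  - by rewrite !le_min => /and3P[_ zr _]; exact: F0.
apply: filterS2 zero_near r3V => p [z zr Fz] Vp.
have [J [J2 fJ JE]] := norm_stem_zero (rU z zr) Fz.
exists (slice_point J z) => //.
exact: Vp (rr3 z zr) (rU z zr) J2 fJ JE.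
Unshelve. all: by end_near. Qed.

End OpenMapping.

Theorem theorem1p16 (R : realType) (Omega : set (quaternion R))
    (f : quaternion R -> quaternion R)
    (slice_domain_Omega : slice_domain Omega)
    (symmetric_Omega : axially_symmetric Omega)
    (regular_f : slice_regular Omega f) :
  open_map_on (Omega `\` closure (degenerate_set Omega f)) f.
Proof.
move=> U UA /open_subspaceP[V oV]; rewrite (setIidl UA) => VA.
have [[oO _] _ _] := slice_domain_Omega.
have oU : open U.
  rewrite -VA; apply: openI => //; rewrite setDE; apply: openI => //.
  exact/closed_openC/closed_closure.
rewrite openE => _ [q Uq <-].
exact: (nbhs_image slice_domain_Omega symmetric_Omega regular_f oU UA Uq).
Qed.
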